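(* For every natural number $n$ and every complete geometric graph $\mathsf{K}_n$ of order $n$, there exists a decomposition $[\mathsf{K}_n,P]$ of $\mathsf{K}_n$ such that \[\chi'([\mathsf{K}_n,P])\geq \frac{n^{2}}{24.5}-\Theta(n).\]
   Context: A geometric graph is a drawing of a graph in the plane whose vertices are points in general position (no three collinear) and whose edges are straight-line segments; a complete geometric graph $\mathsf{K}_n$ of order $n$ is the geometric graph on $n$ points in general position with all $\binom n2$ segments as edges. A decomposition $[G,P]$ of a graph $G$ is a set $P$ of non-empty induced subgraphs of $G$ such that every edge of $G$ belongs to exactly one member of $P$; for $G=\mathsf{K}_n$ the members of $P$ are therefore complete geometric subgraphs. Two geometric graphs have nonempty intersection if they share a vertex or some edge of one crosses some edge of the other. A $k$-$P$-coloring of $[\mathsf{K}_n,P]$ assigns to each edge one of $k$ colors so that all edges of each $\mathsf{H}\in P$ get the same color and any two members of $P$ with nonempty intersection get different colors. The chromatic index $\chi'([\mathsf{K}_n,P])$ is the least $k$ for which a $k$-$P$-coloring exists. The term $\Theta(n)$ denotes a function of $n$ bounded above and below by positive constant multiples of $n$, independent of the point set. *)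

(* Defs.v *)
From HB Require Import structures.
From mathcomp Require Import all_boot all_order all_algebra.
From mathcomp Require Import boolp classical_sets set_interval reals.
Set Implicit Arguments.
Unset Strict Implicit.
Unset Printing Implicit Defensive.
Import Order.TTheory GRing.Theory Num.Theory.
Local Open Scope classical_set_scope.
Local Open Scope ring_scope.

Section Plane.
Variable R : realType.
Implicit Types x y z q v : 'rV[R]_2.

Definition line q v : set 'rV[R]_2 := [set q + t *: v | t in [set: R]].

Definition open_segment x y : set 'rV[R]_2 :=
  [set (1 - t) *: x + t *: y | t in `]0, 1[ ].

Definition collinear x y z : Prop :=
  exists q v, v != 0 /\ [/\ line q v x, line q v y & line q v z].

End Plane.

(* A complete geometric graph of order n is given by its vertices             *)
(* p : 'I_n -> 'rV[R]_2; its edges are the 2-element sets of indices.         *)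
Definition general_position (R : realType) (n : nat) (p : 'I_n -> 'rV[R]_2) :
    Prop :=
  injective p /\
  forall i j k : 'I_n, uniq [:: i; j; k] -> ~ collinear (p i) (p j) (p k).

Definition edge (n : nat) : Type := {e : {set 'I_n} | #|e| == 2%N}.

(* An induced subgraph of K_n is identified with its vertex set A, and e is   *)
(* an edge of it exactly when e is contained in A.                            *)
Definition edge_of (n : nat) (A : {set 'I_n}) (e : edge n) : bool :=
  val e \subset A.

Record decomposition (n : nat) := Decomposition {
  members :> {set {set 'I_n}};
  members_nonempty : forall A, A \in members -> A != finset.set0;
  members_edge : forall e : edge n, exists! A, A \in members /\ edge_of A e
}.

Section ChromaticIndex.
Variables (R : realType) (n : nat) (p : 'I_n -> 'rV[R]_2).

Definition edge_interior (e : edge n) : set 'rV[R]_2 :=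
  [set x | exists i j : 'I_n,
     val e = finset.setU [set i]%SET [set j]%SET /\
     open_segment (p i) (p j) x].

Definition cross (e f : edge n) : Prop :=
  exists x, edge_interior e x /\ edge_interior f x.

Definition intersecting (A B : {set 'I_n}) : Prop :=
  (exists i, i \in A /\ i \in B) \/
  (exists e f : edge n, [/\ edge_of A e, edge_of B f & cross e f]).

(* Only edges carry colours, so one-vertex members impose no constraint. *)
Definition P_coloring (P : decomposition n) (k : nat) (c : edge n -> 'I_k) :
    Prop :=
  (forall A, A \in members P ->
     forall e f, edge_of A e -> edge_of A f -> c e = c f) /\
  (forall A B, A \in members P -> B \in members P -> A != B ->
     intersecting A B ->
     forall e f, edge_of A e -> edge_of B f -> c e != c f).

Definition colorable (P : decomposition n) (k : nat) : Prop :=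
  exists c : edge n -> 'I_k, P_coloring P c.

Lemma exists_colorable (P : decomposition n) : exists k, `[< colorable P k >].
Proof.
have /choice[g gP] : forall e : edge n, exists A,
    unique (fun A => A \in members P /\ edge_of A e) A.
  by move=> e; have [A HA] := members_edge P e; exists A.
have gE A e : A \in members P -> edge_of A e -> g e = A.
  by move=> AP eA; have [_ ] := gP e; apply.
exists #|{set 'I_n}|; apply/asboolP; exists (fun e => enum_rank (g e)); split.
  by move=> A AP e f eA fA; rewrite (gE A e) // (gE A f).
move=> A B AP BP neAB _ e f eA fB.
by rewrite (gE A e) // (gE B f) // (inj_eq enum_rank_inj).
Qed.

Definition chromatic_index (P : decomposition n) : nat :=
  ex_minn (exists_colorable P).

End ChromaticIndex.

(* The bounds are required for all n, not just eventually. *)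
Definition Theta_n (R : realType) (f : nat -> R) : Prop :=
  exists a b : R, [/\ 0 < a, 0 < b &
    forall n : nat, a * n%:R <= f n <= b * n%:R].

(* Main.v *)
(* Let q be about n/7, and set aside the n - (6q + 1) points of largest first *)
(* coordinate. While a median line of the remaining points turns by pi, the   *)
(* two lines that cut off q, respectively 2q, of them on either side meet it  *)
(* at heights that exchange their order; hence at some moment the three lines *)
(* concur at a point o and cut these points into six sectors of about q       *)
(* points each. A triangle with one vertex in each odd sector, or one in each *)
(* even sector, contains o. For an odd m close to q, both parities, and x, y  *)
(* in Z/m, take the x-th, y-th and (x + y)-th points of the three sectors     *)
(* together with the (x + 2y)-th of the points set aside. These 2m^2          *)
(* quadruples pairwise share at most one point, so single edges complete them *)
(* to a decomposition. Two of them without a common vertex cross: two         *)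
(* triangles containing o have meeting sides or are nested, and in the latter *)
(* case the segment from the inner triangle to its fourth point, which lies   *)
(* outside both triangles, leaves the outer one. Hence all 2m^2 quadruples    *)
(* get different colours.                                                     *)
Require Import Defs.
From mathcomp Require Import all_boot all_order all_algebra.
From mathcomp Require Import zify ring lra.
From mathcomp Require Import boolp classical_sets reals.
From mathcomp Require Import topology normedtype.
Set Implicit Arguments.
Unset Strict Implicit.
Unset Printing Implicit Defensive.
Import Order.TTheory GRing.Theory Num.Theory.
Import numFieldNormedType.Exports.
Local Open Scope classical_set_scope.
Local Open Scope ring_scope.

(** * Triangles and segments *)

(** Members that pairwise intersect and contain an edge need distinct colors
    ([chromatic_index_clique]), and vertex sets that pairwise share at most one vertex extend to a
    decomposition ([packing_decomposition]). Hence it suffices to find 2m^2 quadruples, with m = n/7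
    up to a bounded error, that pairwise share at most one vertex and yet pairwise intersect:
    2(n/7)^2 is n^2/24.5, and the bounded error in m costs only a linear term.

    Sharing at most one vertex is algebra: two of the forms x, y, x + y, x + 2y determine x and y
    modulo an odd m ([coordinates_determine], [blocks_meet]). Intersecting is geometry: all
    triangles contain one point o ([concurrent_sectors]) and no fourth point lies in another block's
    triangle ([rightmost_outside]), which forces a crossing ([meet_tetrads]).

    The point o comes from connectedness used twice in [concurrent_lines], once in the direction of
    the median line and once in the height along it. General position limits the points lost on the
    three lines, so every sector keeps at least q - 8 points. *)

Section Triangles.
Variable R : realFieldType.
Implicit Types a b c u v w q : R * R.

Definition det3 a b c := (b.1 - a.1) * (c.2 - a.2) - (b.2 - a.2) * (c.1 - a.1).

Definition comb (s : R) a b : R * R :=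
  ((1 - s) * a.1 + s * b.1, (1 - s) * a.2 + s * b.2).

Definition on_segment a b q := exists2 s, 0 <= s <= 1 & q = comb s a b.

(** The closed triangle for a counterclockwise triple. By [det3_split] the three values add up to
    [det3 a b c]; they are the unnormalized barycentric coordinates of u. *)
Definition in_triangle a b c u :=
  [/\ 0 <= det3 a b u, 0 <= det3 b c u & 0 <= det3 c a u].

Lemma det3_rot a b c : det3 b c a = det3 a b c.
Proof. rewrite /det3; ring. Qed.

Lemma det3_split a b c u : det3 a b u + det3 b c u + det3 c a u = det3 a b c.
Proof. rewrite /det3; ring. Qed.

Lemma det3_comb a b s u w :
  det3 a b (comb s u w) = (1 - s) * det3 a b u + s * det3 a b w.
Proof. rewrite /det3 /comb /=; ring. Qed.

Lemma in_triangle_rot a b c u : in_triangle a b c u -> in_triangle b c a u.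
Proof. by case. Qed.

Lemma on_segment_trans a b q r :
  on_segment a b q -> on_segment q a r -> on_segment a b r.
Proof.
case=> s /andP[s0 s1] -> [s' /andP[s'0 s'1] ->].
exists ((1 - s') * s); first by apply/andP; split; nra.
rewrite /comb /=; congr (_, _); ring.
Qed.

Lemma in_triangle_convex a b c u w q :
  in_triangle a b c u -> in_triangle a b c w -> on_segment u w q ->
  in_triangle a b c q.
Proof.
move=> [u1 u2 u3] [w1 w2 w3] [s /andP[s0 s1] ->].
by split; rewrite det3_comb addr_ge0 // mulr_ge0 // subr_ge0.
Qed.

Lemma on_edge a b c q : 0 < det3 a b c ->
  in_triangle a b c q -> det3 a b q = 0 -> on_segment a b q.
Proof.
move=> D [_ q2 q3] q1.
have S : det3 b c q + det3 c a q = det3 a b c.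
  by rewrite -(det3_split a b c q) q1 add0r.
exists (det3 c a q / det3 a b c).
  by apply/andP; split; [exact: divr_ge0 (ltW D) | rewrite ler_pdivrMr // mul1r -S lerDr].
have Dn : det3 a b c != 0 by rewrite gt_eqF.
(* Barycentric coordinates of q; the weight of c vanishes, so q is a convex combination of a and
   b. *)
have e1 : q.1 * det3 a b c = det3 b c q * a.1 + det3 c a q * b.1 + det3 a b q * c.1.
  by rewrite /det3; ring.
have e2 : q.2 * det3 a b c = det3 b c q * a.2 + det3 c a q * b.2 + det3 a b q * c.2.
  by rewrite /det3; ring.
rewrite q1 mul0r addr0 in e1 e2.
have W : 1 - det3 c a q / det3 a b c = det3 b c q / det3 a b c.
  by apply: (mulIf Dn); rewrite mulrBl !divfK // mul1r -S addrK.
rewrite /comb W [LHS]surjective_pairing; congr (_, _); apply: (mulIf Dn).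
  by rewrite e1; field.
by rewrite e2; field.
Qed.

(* The segment leaves the triangle where the first of the three affine        *)
(* functions cutting it out vanishes.                                         *)
Lemma triangle_exit_aux a b c u w : 0 < det3 a b c ->
  in_triangle a b c u -> det3 a b w < 0 ->
  (forall s, 0 <= s <= 1 -> det3 a b (comb s u w) = 0 ->
     in_triangle a b c (comb s u w)) ->
  exists2 q, on_segment u w q & on_segment a b q.
Proof.
move=> D [u1 u2 u3] w1 H.
pose s := det3 a b u / (det3 a b u - det3 a b w).
have d0 : 0 < det3 a b u - det3 a b w by lra.
have s01 : 0 <= s <= 1.
  apply/andP; split; first exact: divr_ge0 (ltW d0).
  by rewrite ler_pdivrMr // mul1r; lra.
have z : det3 a b (comb s u w) = 0.
  by rewrite det3_comb /s; field; rewrite gt_eqF.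
exists (comb s u w); first by exists s.
exact: on_edge D (H s s01 z) z.
Qed.

Lemma triangle_exit a b c u w : 0 < det3 a b c ->
  in_triangle a b c u -> ~ in_triangle a b c w ->
  exists2 q, on_segment u w q &
    [\/ on_segment a b q, on_segment b c q | on_segment c a q].
Proof.
move=> D Tu nTw.
(* The parameter at which an affine f vanishes on the way from u to w. The exit is through the side
   with the smallest key among those negative at w, since there the other two functions are still
   nonnegative. *)
pose key (f : R * R -> R) := f u / (f u - f w).
have key1 f s : 0 <= f u -> f w < 0 -> s <= key f ->
    0 <= (1 - s) * f u + s * f w.
  move=> fu fw; have d : 0 < f u - f w by lra.
  rewrite /key ler_pdivlMr // => h; lra.
have key2 f s : 0 <= f u -> 0 <= f w -> 0 <= s <= 1 ->
    0 <= (1 - s) * f u + s * f w.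
  by move=> fu fw /andP[s0 s1]; rewrite addr_ge0 // mulr_ge0 // subr_ge0.
have key0 f s : 0 <= f u -> f w < 0 -> (1 - s) * f u + s * f w = 0 ->
    s = key f.
  move=> fu fw h; have d : f u - f w != 0 by rewrite gt_eqF //; lra.
  by rewrite /key; apply: (mulIf d); rewrite divfK //; lra.
have [u1 u2 u3] := Tu.
have main (x y z : R * R) : 0 < det3 x y z -> in_triangle x y z u ->
    det3 x y w < 0 ->
    (det3 y z w < 0 -> key (det3 x y) <= key (det3 y z)) ->
    (det3 z x w < 0 -> key (det3 x y) <= key (det3 z x)) ->
    exists2 q, on_segment u w q & on_segment x y q.
  move=> D' T' w1 h2 h3; apply: (triangle_exit_aux D' T' w1) => s s01 z0.
  have [v1 v2 v3] := T'.
  have sk : s = key (det3 x y) by apply: key0; rewrite // -det3_comb.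
  split; first by rewrite z0.
    rewrite det3_comb; have [h|h] := ltP (det3 y z w) 0.
      by apply: key1; rewrite // sk; exact: h2.
    exact: key2.
  rewrite det3_comb; have [h|h] := ltP (det3 z x w) 0.
    by apply: key1; rewrite // sk; exact: h3.
  exact: key2.
have D2 : 0 < det3 b c a by rewrite det3_rot.
have D3 : 0 < det3 c a b by rewrite det3_rot.
have T2 := in_triangle_rot Tu; have T3 := in_triangle_rot T2.
have r1 : det3 a b w < 0 ->
    (det3 b c w < 0 -> key (det3 a b) <= key (det3 b c)) ->
    (det3 c a w < 0 -> key (det3 a b) <= key (det3 c a)) ->
    exists2 q, on_segment u w q &
    [\/ on_segment a b q, on_segment b c q | on_segment c a q].
  by move=> h1 h2 h3; have [q ? ?] := main _ _ _ D Tu h1 h2 h3; exists q; last by constructor 1.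
have r2 : det3 b c w < 0 ->
    (det3 c a w < 0 -> key (det3 b c) <= key (det3 c a)) ->
    (det3 a b w < 0 -> key (det3 b c) <= key (det3 a b)) ->
    exists2 q, on_segment u w q &
    [\/ on_segment a b q, on_segment b c q | on_segment c a q].
  by move=> h1 h2 h3; have [q ? ?] := main _ _ _ D2 T2 h1 h2 h3; exists q; last by constructor 2.
have r3 : det3 c a w < 0 ->
    (det3 a b w < 0 -> key (det3 c a) <= key (det3 a b)) ->
    (det3 b c w < 0 -> key (det3 c a) <= key (det3 b c)) ->
    exists2 q, on_segment u w q &
    [\/ on_segment a b q, on_segment b c q | on_segment c a q].
  by move=> h1 h2 h3; have [q ? ?] := main _ _ _ D3 T3 h1 h2 h3; exists q; last by constructor 3.
set k1 := key _ in r1 r2 r3; set k2 := key (det3 b c) in r1 r2 r3.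
set k3 := key (det3 c a) in r1 r2 r3.
(* Only the order of the three keys matters from here on; the last two alternatives below discard
   cyclic orders. *)
clearbody k1 k2 k3.
have [h1|h1] := ltP (det3 a b w) 0; have [h2|h2] := ltP (det3 b c w) 0;
  have [h3|h3] := ltP (det3 c a w) 0; last by case: nTw.
all: have [l12|l12] := leP k1 k2; have [l23|l23] := leP k2 k3; have [l13|l13] := leP k1 k3.
all: first
  [ by apply: r1 => // h; first [exact: ltW | by move: h; rewrite ltNge h2 | by move: h; rewrite ltNge h3]
  | by apply: r2 => // h; first [exact: ltW | by move: h; rewrite ltNge h1 | by move: h; rewrite ltNge h3]
  | by apply: r3 => // h; first [exact: ltW | by move: h; rewrite ltNge h1 | by move: h; rewrite ltNge h2]
  | by have := le_lt_trans (le_trans l12 l23) l13; rewrite ltxx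
  | by have := lt_le_trans (lt_trans l23 l12) l13; rewrite ltxx ].
Qed.

End Triangles.

(** * Crossings of two four-point blocks *)

Section Crossing.
Variables (R : realFieldType) (I : eqType) (P : I -> R * R).

(** Segments are closed here; general position later turns a meeting point into an interior one. *)
Definition meet (s t : seq I) := exists i j k l q,
  [/\ [&& i \in s, j \in s & i != j], [&& k \in t, l \in t & k != l],
      on_segment (P i) (P j) q & on_segment (P k) (P l) q].

Lemma meetC s t : meet s t -> meet t s.
Proof. by case=> i [j [k [l [q [? ? ? ?]]]]]; exists k, l, i, j, q. Qed.

Lemma meet_edge a b c (s : seq I) k l q : uniq [:: a; b; c] ->
  {subset [:: a; b; c] <= s} -> forall t, [&& k \in t, l \in t & k != l] ->
  on_segment (P k) (P l) q ->
  [\/ on_segment (P a) (P b) q, on_segment (P b) (P c) q |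
      on_segment (P c) (P a) q] -> meet s t.
Proof.
rewrite /= !inE negb_or !andbT => /andP[/andP[ab ac] bc] sub t kl q1.
have [sa sb sc] : [/\ a \in s, b \in s & c \in s].
  by split; apply: sub; rewrite !inE eqxx ?orbT.
case=> q2; [exists a, b, k, l, q|exists b, c, k, l, q|exists c, a, k, l, q];
  by split=> //; rewrite ?sa ?sb ?sc //= eq_sym.
Qed.

Lemma meet_inside a b c d s i : uniq [:: a; b; c] ->
  0 < det3 (P a) (P b) (P c) -> i \in s -> d \in s -> i != d ->
  in_triangle (P a) (P b) (P c) (P i) -> ~ in_triangle (P a) (P b) (P c) (P d) ->
  forall e, meet [:: a; b; c; e] s.
Proof.
move=> u D si sd ned Ti Td e.
have [q q1 q2] := triangle_exit D Ti Td.
apply: (@meet_edge a b c _ i d q u _ s _ q1 q2); last by rewrite si sd.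
by move=> x; rewrite !inE => /or3P[] ->; rewrite ?orbT.
Qed.

(* Two triangles with a common point are nested unless their sides meet; when *)
(* they are nested, the segments from the inner one to its fourth vertex,     *)
(* which lies outside the outer one, cross the latter.                        *)
Lemma meet_tetrads a b c d a' b' c' d' o :
  uniq [:: a; b; c; d; a'; b'; c'; d'] ->
  0 < det3 (P a) (P b) (P c) -> 0 < det3 (P a') (P b') (P c') ->
  in_triangle (P a) (P b) (P c) o -> in_triangle (P a') (P b') (P c') o ->
  ~ in_triangle (P a) (P b) (P c) (P d') ->
  ~ in_triangle (P a') (P b') (P c') (P d) ->
  meet [:: a; b; c; d] [:: a'; b'; c'; d'].
Proof.
move=> U D D' To To' Td' Td.
have : uniq ([:: a; b; c; d] ++ [:: a'; b'; c'; d']) := U.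
rewrite cat_uniq -[[:: a; b; c; d]]/(rcons [:: a; b; c] d).
rewrite -[[:: a'; b'; c'; d']]/(rcons [:: a'; b'; c'] d') !rcons_uniq.
case/and3P=> /andP[nd u] _ /andP[nd' u'].
have ne x : x \in [:: a'; b'; c'] -> x != d' by apply: contraTneq => ->.
have ne' x : x \in [:: a; b; c] -> x != d by apply: contraTneq => ->.
have [[x xs Tx]|out'] := pselect (exists2 x, x \in [:: a'; b'; c'] & in_triangle (P a) (P b) (P c) (P x)).
  apply: (meet_inside u D _ _ (ne x xs) Tx Td').
    by move: xs; rewrite !inE => /or3P[] ->; rewrite ?orbT.
  by rewrite !inE eqxx !orbT.
have [[x xs Tx]|out] := pselect (exists2 x, x \in [:: a; b; c] & in_triangle (P a') (P b') (P c') (P x)).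
  apply: meetC; apply: (meet_inside u' D' _ _ (ne' x xs) Tx Td).
    by move: xs; rewrite !inE => /or3P[] ->; rewrite ?orbT.
  by rewrite !inE eqxx !orbT.
(* No vertex of either triangle lies in the other. The segment from o to a' leaves the first
   triangle at a point q of a side; q belongs to the second triangle by convexity, and an endpoint
   of that side does not, so the side crosses the boundary of the second. *)
have nA : ~ in_triangle (P a) (P b) (P c) (P a').
  by move=> h; apply: out'; exists a'; rewrite ?inE ?eqxx.
have out1 x : x \in [:: a; b; c] -> ~ in_triangle (P a') (P b') (P c') (P x).
  by move=> xs h; apply: out; exists x.
have [q q1 q2] := triangle_exit D To nA.
have Ta' : in_triangle (P a') (P b') (P c') (P a').
  have e x y : det3 x y x = 0 :> R by rewrite /det3; ring.
  have e' x y : det3 x y y = 0 :> R by rewrite /det3; ring.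
  by split; rewrite ?e ?e' ?lexx // det3_rot ltW.
have Tq := in_triangle_convex To' Ta' q1.
have key x y : x \in [:: a; b; c] -> y \in [:: a; b; c] -> x != y ->
    on_segment (P x) (P y) q -> meet [:: a; b; c; d] [:: a'; b'; c'; d'].
  move=> xs ys xy q3.
  have [r r1 r2] := triangle_exit D' Tq (out1 x xs).
  apply: meetC.
  apply: (@meet_edge a' b' c' _ x y r u' _ [:: a; b; c; d] _ _ r2).
  - by move=> z; rewrite !inE => /or3P[] ->; rewrite ?orbT.
  - rewrite xy andbT; apply/andP; split; [move: xs|move: ys];
      by rewrite !inE => /or3P[] ->; rewrite ?orbT.
  - exact: on_segment_trans q3 r1.
move: u; rewrite /= !inE negb_or !andbT => /andP[/andP[ab ac] bc].
case: q2 => q2; [apply: (key a b)|apply: (key b c)|apply: (key c a)] => //;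
  by rewrite ?inE ?eqxx ?orbT // eq_sym.
Qed.

Hypothesis gp : forall i j k, uniq [:: i; j; k] -> det3 (P i) (P j) (P k) != 0.

(** An endpoint as meeting point would be collinear with k and l. *)
Lemma on_segment_interior i j k l q :
  uniq [:: i; k; l] -> uniq [:: j; k; l] ->
  on_segment (P i) (P j) q -> on_segment (P k) (P l) q ->
  exists2 s, 0 < s < 1 & q = comb s (P i) (P j).
Proof.
move=> u2 u3 [s /andP[s0 s1] qs] [r _ qr].
have col : det3 (P k) (P l) q = 0 by rewrite qr /det3 /comb /=; ring.
exists s => //; rewrite !lt_neqAle s0 s1 !andbT; apply/andP; split.
  apply: contraNneq (gp u2) => s0'; rewrite det3_rot -col qs -s0' /det3 /comb /=.
  by apply/eqP; ring.
apply: contraNneq (gp u3) => s1'; rewrite det3_rot -col qs s1' /det3 /comb /=.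
by apply/eqP; ring.
Qed.

End Crossing.

(** * Medians and thresholds *)

Section OrderStatistics.
Variables (R : realDomainType) (I : finType).
Implicit Types (A B S : {set I}) (f g : I -> R).

Definition below A f (z : R) := [set i in A | f i <= z].
Definition above A f (z : R) := [set i in A | z <= f i].

Lemma below_mono A f z z' : z <= z' -> (#|below A f z| <= #|below A f z'|)%N.
Proof.
move=> zz'; apply/subset_leq_card/fintype.subsetP => i; rewrite !inE => /andP[-> h] /=.
exact: le_trans zz'.
Qed.

Lemma above_mono A f z z' : z <= z' -> (#|above A f z'| <= #|above A f z|)%N.
Proof.
move=> zz'; apply/subset_leq_card/fintype.subsetP => i; rewrite !inE => /andP[-> h] /=.
exact: le_trans h.
Qed.

Lemma card_below_lt A f z :
  (#|[set i in A | (f i < z)%R]| + #|above A f z|)%N = #|A|.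
Proof.
rewrite -(cardsID [set i | z <= f i] A) addnC; congr (_ + _)%N; apply: eq_card => i.
  by rewrite !inE andbC.
by rewrite !inE -ltNge andbC.
Qed.

(** Here z is the k-th smallest value, so fewer than k elements lie strictly below it. For k = 0 no
    z satisfies that strict bound, hence the disjunct. *)
Lemma order_statistic A f k : (k <= #|A|)%N ->
  exists2 z, (k <= #|below A f z|)%N & (#|A| < k + #|above A f z|)%N \/ k = 0%N.
Proof.
case: k => [_|k kA]; first by exists 0; [|right].
have /card_gt0P[i1 i1A] : (0 < #|A|)%N by exact: leq_trans kA.
have [i0 i0A max0] : exists2 i, i \in A & forall j, j \in A -> f j <= f i.
  by case: (@arg_maxP _ R I i1 (mem A) f i1A) => i iA h; exists i.
pose P i := (i \in A) && (k < #|below A f (f i)|)%N.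
have P0 : P i0.
  rewrite /P i0A /=; apply: leq_trans kA _; apply/subset_leq_card/fintype.subsetP => j jA.
  by rewrite inE jA max0.
case: (@arg_minP _ R I i0 P f P0) => i /andP[iA ki] min_i.
exists (f i) => //; left; rewrite ltnNge; apply/negP => le.
pose A' := [set j in A | f j < f i].
have kA' : (k < #|A'|)%N.
  by have := card_below_lt A f (f i); rewrite -/A'; move: le; set a := #|A'|; lia.
have /card_gt0P[j1 j1A'] : (0 < #|A'|)%N by exact: leq_trans kA'.
have [j jA' max_j] : exists2 i, i \in A' & forall j, j \in A' -> f j <= f i.
  by case: (@arg_maxP _ R I j1 (mem A') f j1A') => j jA h; exists j.
move: (jA'); rewrite inE => /andP[jA ji].
have : P j.
  rewrite /P jA /=; apply: leq_trans kA' _; apply/subset_leq_card/fintype.subsetP => l lA'.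
  by rewrite inE max_j // andbT; move: lA'; rewrite inE => /andP[].
by move=> /min_i; rewrite leNgt ji.
Qed.

Definition is_median S M f (c : R) :=
  (M < #|below S f c|)%N /\ (M < #|above S f c|)%N.

Lemma median_exists S M f : #|S| = M.*2.+1 -> exists c, is_median S M f c.
Proof.
move=> SM; have [|z le_z [lt_z|//]] := @order_statistic S f M.+1.
  by rewrite SM; lia.
by exists z; split=> //; move: lt_z; rewrite SM; lia.
Qed.

(** Otherwise the M + 1 elements with f at most c and the M + 1 with g at least d would be disjoint.
    With e = 0 this gives uniqueness of the median, with e > 0 its continuity. *)
Lemma median_le S M f g c d (e : R) : #|S| = M.*2.+1 ->
  (forall i, i \in S -> g i <= f i + e) ->
  is_median S M f c -> is_median S M g d -> d <= c + e.
Proof.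
move=> SM fg [fc _] [_ gd]; rewrite leNgt; apply/negP => cd.
have := leq_add fc gd; rewrite leqNgt => /negP; apply.
have dis : [disjoint below S f c & above S g d]%B.
  apply/pred0P => i; rewrite /= !inE; apply/negbTE/negP.
  move=> /andP[/andP[iS h1] /andP[_ h2]].
  by have := fg i iS; lra.
have /eqP <- : (#|below S f c :|: above S g d| == #|below S f c| + #|above S g d|)%N.
  by rewrite (leq_card_setU _ _).2.
apply: leq_ltn_trans (_ : #|S| < _)%N; last by rewrite SM; lia.
by apply/subset_leq_card/fintype.subsetP => i; rewrite !inE => /orP[] /andP[].
Qed.

(* Clamping the relevant order statistic to the interval between the two      *)
(* given thresholds yields one threshold serving both families.               *)
Lemma common_threshold A B f g a b (z z' : R) :
  (a + b <= #|A|)%N -> (a + b <= #|B|)%N ->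
  (a <= #|below A f z|)%N -> (b <= #|above B g z|)%N ->
  (b <= #|above A f z'|)%N -> (a <= #|below B g z'|)%N ->
  exists w, [/\ (a <= #|below A f w|)%N, (b <= #|above A f w|)%N,
                (a <= #|below B g w|)%N & (b <= #|above B g w|)%N].
Proof.
have key A' f' : (a + b <= #|A'|)%N -> exists2 w, (a <= #|below A' f' w|)%N & (b <= #|above A' f' w|)%N \/ a = 0%N.
  move=> h; have [|w w1 [w2|w2]] := @order_statistic A' f' a; first by lia.
    by exists w => //; left; lia.
  by exists w => //; right.
have clamp A' B' f' g' (y y' : R) : (a + b <= #|A'|)%N ->
    (a <= #|below A' f' y|)%N -> (b <= #|above B' g' y|)%N ->
    (b <= #|above A' f' y'|)%N -> (a <= #|below B' g' y'|)%N -> y' <= y ->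
    exists w, [/\ (a <= #|below A' f' w|)%N, (b <= #|above A' f' w|)%N,
                (a <= #|below B' g' w|)%N & (b <= #|above B' g' w|)%N].
  move=> h h1 h2 h3 h4 yy.
  have [w w1 w2] := key A' f' h.
  have [a0|a0] := eqVneq a 0%N.
    exists y'; split; rewrite ?a0 //.
    exact: leq_trans (above_mono _ _ yy).
  have {}w2 : (b <= #|above A' f' w|)%N by case: w2 => // w2; rewrite w2 in a0.
  have [wy'|wy'] := leP w y'.
    exists y'; split=> //; [exact: leq_trans (below_mono _ _ wy')|exact: leq_trans (above_mono _ _ yy)].
  have [wy|wy] := leP w y; last first.
    exists y; split=> //; [exact: leq_trans (above_mono _ _ (ltW wy))|exact: leq_trans (below_mono _ _ yy)].
  by exists w; split=> //; [exact: leq_trans (below_mono _ _ (ltW wy'))|exact: leq_trans (above_mono _ _ wy)].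
move=> hA hB h1 h2 h3 h4.
have [zz|zz] := leP z' z; first exact: clamp zz.
by have [w [w1 w2 w3 w4]] := clamp B A g f z' z hB h4 h3 h2 h1 (ltW zz); exists w.
Qed.

End OrderStatistics.


(** * Three concurrent lines *)

Section Connectedness.
Variable R : realType.

(** Connectedness of the real line, applied to two nonempty closed sets that cover it; closedness is
    phrased as openness of the complements. *)
Lemma closed_cover_meet (A B : R -> Prop) a b : A a -> B b ->
  (forall x, A x \/ B x) ->
  (forall x, ~ A x -> \forall y \near x, ~ A y) ->
  (forall x, ~ B x -> \forall y \near x, ~ B y) ->
  exists x, A x /\ B x.
Proof.
move=> Aa Bb AB cA cB; apply: contrapT => nAB.
have AE : [set x | A x] = ~` [set x | B x].
  apply/seteqP; split=> x /=; first by move=> Ax Bx; apply: nAB; exists x.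
  by case: (AB x).
have oA : open [set x | A x] by rewrite AE openE => x; apply: cB.
have clA : closed [set x | A x].
  by rewrite -openC openE => x; apply: cA.
have conn : connected [set: R] by apply/connected_intervalP => x y _ _ z _.
have AT : [set x | A x] = setT.
  apply: conn; first by exists a.
    by exists [set x | A x]; rewrite // setTI.
  by exists [set x | A x]; rewrite // setTI.
have Ab : [set x | A x] b by rewrite AT.
by apply: nAB; exists b.
Qed.

End Connectedness.

(** * Heights on a median line *)

Section Halves.
Variables (R : realType) (I : finType) (S : {set I}).

(** All inequalities are weak, and the pairs U, V are finitely many, so the condition is closed in
    every parameter on which [xc] and [g] depend continuously. *)
Definition fits (xc : I -> R) (g : I -> I -> R) (a b : nat) :=
  exists U V : {set I}, [/\ U \subset S, V \subset S,
    (a <= #|U|)%N, (b <= #|V|)%N &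
    [/\ forall i, i \in U -> 0 <= xc i, forall j, j \in V -> xc j <= 0 &
        forall i j, i \in U -> j \in V -> g i j <= 0]].

Lemma fits_closed (xc : R -> I -> R) (g : R -> I -> I -> R) a b s0 :
  (forall i, {for s0, continuous (xc^~ i)}) ->
  (forall i j, {for s0, continuous (fun s => g s i j)}) ->
  ~ fits (xc s0) (g s0) a b -> \forall s \near s0, ~ fits (xc s) (g s) a b.
Proof.
move=> cx cg nf.
pose Q s (UV : {set I} * {set I}) :=
    [/\ UV.1 \subset S, UV.2 \subset S, (a <= #|UV.1|)%N, (b <= #|UV.2|)%N &
    [/\ forall i, i \in UV.1 -> 0 <= xc s i, forall j, j \in UV.2 -> xc s j <= 0 &
        forall i j, i \in UV.1 -> j \in UV.2 -> g s i j <= 0]].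
suff : \forall s \near s0, forall UV, ~ Q s UV.
  by apply: filterS => s h [U [V hUV]]; exact: (h (U, V)).
apply: (@filter_forall R _ (fun UV s => ~ Q s UV) (nbhs s0)) => -[U V].
rewrite /Q /=.
have {nf} : ~ [/\ U \subset S, V \subset S, (a <= #|U|)%N, (b <= #|V|)%N &
    [/\ forall i, i \in U -> 0 <= xc s0 i, forall j, j \in V -> xc s0 j <= 0 &
        forall i j, i \in U -> j \in V -> g s0 i j <= 0]].
  by move=> h; apply: nf; exists U, V.
have [[US VS aU bV] nf|nf _] := pselect [/\ U \subset S, V \subset S, (a <= #|U|)%N & (b <= #|V|)%N]; last first.
  by apply: filterE => s [? ? ? ? _]; apply: nf.
have {}nf : ~ [/\ forall i, i \in U -> 0 <= xc s0 i, forall j, j \in V -> xc s0 j <= 0 &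
        forall i j, i \in U -> j \in V -> g s0 i j <= 0] by move=> ?; apply: nf.
have [[i iU xi]|n1] := pselect (exists2 i, i \in U & xc s0 i < 0).
  have near_i := @cvgr_lt _ _ _ (nbhs_filter s0) _ _ (cx i) _ xi.
  apply: filterS near_i => s xsi [_ _ _ _ [h _ _]].
  by have := h i iU; rewrite leNgt xsi.
have [[j jV xj]|n2] := pselect (exists2 j, j \in V & 0 < xc s0 j).
  have near_j := @cvgr_gt _ _ _ (nbhs_filter s0) _ _ (cx j) _ xj.
  apply: filterS near_j => s xsj [_ _ _ _ [_ h _]].
  by have := h j jV; rewrite leNgt xsj.
have [[i iU [j jV gij]]|n3] := pselect (exists2 i, i \in U & exists2 j, j \in V & 0 < g s0 i j).
  have near_ij := @cvgr_gt _ _ _ (nbhs_filter s0) _ _ (cg i j) _ gij.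
  apply: filterS near_ij => s gs [_ _ _ _ [_ _ h]].
  by have := h i j iU jV; rewrite leNgt gs.
exfalso; apply: nf; split=> [i iU|j jV|i j iU jV]; rewrite leNgt; apply/negP => h.
- by apply: n1; exists i.
- by apply: n2; exists j.
- by apply: n3; exists i => //; exists j.
Qed.

Variable M : nat.
Implicit Types (x y : I -> R) (c t : R).

(* Sign of the position of (c, t) relative to the line through i and j, when  *)
(* these lie on either side of the vertical line at c.                        *)
Definition side x y c t i j : R :=
  (y j - t) * (x i - c) - (y i - t) * (x j - c).

(** Leaving aside points on the vertical line at c, [low] says that some line through (c, t) has k
    points to the right and M - k to the left on or below it, [high] that some line has M - k to the
    right and k to the left on or above it. Comparing points pairwise avoids a slope, which could
    become infinite in a limit. Both hold where the line cutting off k points meets the median. *)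
Definition low x y c k t :=
  fits (fun i => x i - c) (side x y c t) k (M - k).
Definition high x y c k t :=
  fits (fun i => x i - c) (fun i j => - side x y c t i j) (M - k) k.

Lemma low_le x y c k t t' : t <= t' -> low x y c k t -> low x y c k t'.
Proof.
move=> tt [U [V [US VS kU kV [h1 h2 h3]]]]; exists U, V; split=> //; split=> // i j iU jV.
have := h1 i iU; have := h2 j jV; have := h3 i j iU jV; rewrite /side => *; nra.
Qed.

Lemma high_ge x y c k t t' : t' <= t -> high x y c k t -> high x y c k t'.
Proof.
move=> tt [U [V [US VS kU kV [h1 h2 h3]]]]; exists U, V; split=> //; split=> // i j iU jV.
have := h1 i iU; have := h2 j jV; have := h3 i j iU jV; rewrite /side => *; nra.
Qed.

Section Median.
Variables (x y : I -> R) (c : R) (k : nat).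
Hypotheses (med : is_median S M x c) (kM : (k <= M)%N).

Let right := [set i in S | c <= x i].
Let left := [set i in S | x i <= c].

Let card_right : (M < #|right|)%N. Proof. by case: med. Qed.
Let card_left : (M < #|left|)%N. Proof. by case: med. Qed.

Let right_sub : right \subset S.
Proof. by apply/fintype.subsetP => i; rewrite inE => /andP[]. Qed.

Let left_sub : left \subset S.
Proof. by apply/fintype.subsetP => i; rewrite inE => /andP[]. Qed.

Lemma low_large : exists t0, forall t, t0 <= t -> low x y c k t.
Proof.
exists (\sum_i `|y i|) => t le_t.
have yt i : y i <= t.
  apply: le_trans (ler_norm _) (le_trans _ le_t).
  by rewrite (bigD1 i) //= lerDl sumr_ge0.
exists right, left; split; [exact: right_sub|exact: left_sub|exact: leq_trans kM (ltnW card_right)|exact: leq_trans (leq_subr _ _) (ltnW card_left)|].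
split=> [i|i|i j]; rewrite !inE => /andP[_ h1]; rewrite ?subr_ge0 ?subr_le0 //.
move=> /andP[_ h2]; rewrite /side; have := yt i; have := yt j; nra.
Qed.

Lemma high_small : exists t0, forall t, t <= t0 -> high x y c k t.
Proof.
exists (- \sum_i `|y i|) => t le_t.
have yt i : t <= y i.
  rewrite -lerN2; apply: le_trans (_ : \sum_i `|y i| <= _); last by rewrite lerNr.
  apply: le_trans (ler_norm _) _; rewrite normrN.
  by rewrite [leRHS](bigD1 i) //= lerDl sumr_ge0.
exists right, left; split; [exact: right_sub|exact: left_sub|exact: leq_trans (leq_subr _ _) (ltnW card_right)|exact: leq_trans kM (ltnW card_left)|].
split=> [i|i|i j]; rewrite !inE => /andP[_ h1]; rewrite ?subr_ge0 ?subr_le0 //.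
move=> /andP[_ h2]; rewrite /side; have := yt i; have := yt j; nra.
Qed.

(* Monotone in the angle of (u, v) for u >= 0, also on the vertical axis; at  *)
(* (0, 0) its value is 0/0 = 0.                                               *)
Let key (u v : R) := v / (u + `|v|).

Let key_cross u v u' v' : 0 <= u -> 0 <= u' -> key u v <= key u' v' ->
  v * u' <= v' * u.
Proof.
move=> u0 u'0.
have z (a b : R) : 0 <= a -> a + `|b| = 0 -> a = 0 /\ b = 0.
  move=> a0 ab; have b0 := normr_ge0 b.
  by split; [lra|apply: normr0_eq0; lra].
have [/(z _ _ u0)[-> ->]|d] := eqVneq (u + `|v|) 0; first by rewrite mul0r mulr0.
have [/(z _ _ u'0)[-> ->]|d'] := eqVneq (u' + `|v'|) 0; first by rewrite mul0r mulr0.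
have {}d : 0 < u + `|v| by rewrite lt0r d addr_ge0.
have {}d' : 0 < u' + `|v'| by rewrite lt0r d' addr_ge0.
rewrite /key ler_pdivrMr // mulrAC ler_pdivlMr //.
have [v0|v0] := leP 0 v; have [v'0|v'0] := leP 0 v';
  rewrite ?(ger0_norm v0) ?(ger0_norm v'0) ?(ltr0_norm v0) ?(ltr0_norm v'0) => h; nra.
Qed.

(** Reflect the left points in (c, t) and compare angles: f on the right, g on the left. Cut at the
    k-th smallest angle z on the right. Either M - k left points have angle at least z, which gives
    [low], or more than k have a smaller one, and together with the right points of angle at least z
    they give [high]. *)
Lemma low_or_high t : low x y c k t \/ high x y c k t.
Proof.
pose f i := key (x i - c) (y i - t); pose g i := key (c - x i) (t - y i).
have r0 i : i \in right -> 0 <= x i - c by rewrite inE => /andP[_]; rewrite subr_ge0.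
have l0 i : i \in left -> x i - c <= 0 by rewrite inE => /andP[_]; rewrite subr_le0.
have l0' i : i \in left -> 0 <= c - x i by rewrite inE => /andP[_]; rewrite subr_ge0.
have fg i j : i \in right -> j \in left -> f i <= g j -> side x y c t i j <= 0.
  move=> ir jl /(key_cross (r0 i ir) (l0' j jl)); rewrite /side; lra.
have gf i j : i \in right -> j \in left -> g j <= f i -> - side x y c t i j <= 0.
  move=> ir jl /(key_cross (l0' j jl) (r0 i ir)); rewrite /side; lra.
have sub1 (A : {set I}) (h : I -> R) z : below A h z \subset A.
  by apply/fintype.subsetP => i; rewrite inE => /andP[].
have sub2 (A : {set I}) (h : I -> R) z : above A h z \subset A.
  by apply/fintype.subsetP => i; rewrite inE => /andP[].
have [|z z1 z2] := @order_statistic R I right f k; first by lia.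
have [hl|hl] := leqP (M - k) #|above left g z|.
  left; exists (below right f z), (above left g z).
  split=> //; [exact: fintype.subset_trans right_sub|exact: fintype.subset_trans left_sub|].
  split=> [i iU|j jV|i j]; [exact: r0 i (fintype.subsetP (sub1 _ _ _) _ iU)|exact: l0 j (fintype.subsetP (sub2 _ _ _) _ jV)|].
  rewrite !inE => /andP[/andP[iS ic] iz] /andP[/andP[jS jc] jz].
  by apply: fg; rewrite ?inE ?iS ?jS //; apply: le_trans iz jz.
right; case: z2 => [z2|k0]; last first.
  by move: hl; rewrite k0 subn0 => hl; exists right, finset.set0; rewrite finset.sub0set cards0;
    split=> //; [lia | split=> [i iU|j|i j _]; [exact: r0 i iU|by rewrite finset.in_set0|by rewrite finset.in_set0]].
exists (above right f z), [set j in left | g j < z]; split.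
- exact: fintype.subset_trans right_sub.
- by apply: fintype.subset_trans left_sub; apply/fintype.subsetP => i; rewrite inE => /andP[].
- lia.
- rewrite -(leq_add2r #|above left g z|) card_below_lt.
  by apply: leq_trans (ltnW card_left); move: hl kM; set h := #|_|; lia.
split=> [i iU|j|i j]; [exact: r0 i (fintype.subsetP (sub2 _ _ _) _ iU)| |].
  by rewrite inE => /andP[jl _]; exact: l0.
rewrite !inE => /andP[/andP[iS ic] iz] /andP[/andP[jS jc] jz].
by apply: gf; rewrite ?inE ?iS ?jS //; exact: le_trans (ltW jz) iz.
Qed.

End Median.
End Halves.

(** * Rotation of the median line *)

Section Sweep.
Variables (R : realType) (I : finType) (S : {set I}) (M : nat) (X Y : I -> R).
Hypothesis card_S : #|S| = M.*2.+1.

(* Coordinates along the nonzero vector (s, 1 - s * s), which turns by pi as *)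
(* s runs from -1 to 1, and along its normal.                                 *)
Definition rotx (s : R) i := X i * s + Y i * (1 - s * s).
Definition roty (s : R) i := Y i * s - X i * (1 - s * s).

(** A half turn exchanges right with left and below with above, so the k right points below become
    the k left points above and the index k is kept. *)
Lemma low_high_opp x y x' y' (c : R) k t :
  (forall i, x' i = - x i) -> (forall i, y' i = - y i) ->
  low S M x y c k t -> high S M x' y' (- c) k (- t).
Proof.
move=> xx yy [U [V [US VS kU kV [h1 h2 h3]]]]; exists V, U; split=> //.
split=> [i iV|j jU|i j iV jU]; rewrite ?xx.
- by have := h2 i iV; lra.
- by have := h1 j jU; lra.
- by have := h3 j i jU iV; rewrite /side !xx !yy; lra.
Qed.

Lemma high_low_opp x y x' y' (c : R) k t :
  (forall i, x' i = - x i) -> (forall i, y' i = - y i) ->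
  high S M x y c k t -> low S M x' y' (- c) k (- t).
Proof.
move=> xx yy [U [V [US VS kU kV [h1 h2 h3]]]]; exists V, U; split=> //.
split=> [i iV|j jU|i j iV jU]; rewrite ?xx.
- by have := h2 i iV; lra.
- by have := h1 j jU; lra.
- by have := h3 j i jU iV; rewrite /side !xx !yy; lra.
Qed.

Lemma rotx_continuous i : continuous (rotx ^~ i).
Proof.
move=> s; rewrite /rotx; apply: cvgD; first by apply: cvgMr; exact: cvg_id.
by apply: cvgMr; apply: cvgB; [exact: cvg_cst|apply: cvgM; exact: cvg_id].
Qed.

Lemma roty_continuous i : continuous (roty ^~ i).
Proof.
move=> s; rewrite /roty; apply: cvgB; first by apply: cvgMr; exact: cvg_id.
by apply: cvgMr; apply: cvgB; [exact: cvg_cst|apply: cvgM; exact: cvg_id].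
Qed.

Variable c : R -> R.
Hypothesis med : forall s, is_median S M (rotx s) (c s).

Lemma median_continuous : continuous c.
Proof.
move=> s; apply/cvgrPdist_le => e e0.
have : \forall s' \near s, forall i, `|rotx s i - rotx s' i| <= e.
  apply: (@filter_forall R I (fun i s' => `|rotx s i - rotx s' i| <= e) (nbhs s)) => i.
  by have /cvgrPdist_le := @rotx_continuous i s; apply.
apply: filterS => s' h; rewrite ler_norml; apply/andP; split.
  suff : c s' <= c s + e by lra.
  apply: (median_le card_S _ (med s) (med s')) => i _.
  by have := h i; rewrite ler_norml => /andP[]; lra.
suff : c s <= c s' + e by lra.
apply: (median_le card_S _ (med s') (med s)) => i _.
by have := h i; rewrite ler_norml => /andP[]; lra.
Qed.

Let L k s t := low S M (rotx s) (roty s) (c s) k t.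
Let H k s t := high S M (rotx s) (roty s) (c s) k t.

Let centered_continuous i : continuous (fun s => rotx s i - c s).
Proof. by move=> s; apply: cvgB; [exact: rotx_continuous|exact: median_continuous]. Qed.

Let side_continuous t i j : continuous (fun s => side (rotx s) (roty s) (c s) t i j).
Proof.
move=> s; rewrite /side; apply: cvgB; apply: cvgM; try exact: centered_continuous;
  by apply: cvgB; [exact: roty_continuous|exact: cvg_cst].
Qed.

Let side_continuous_t s i j :
  continuous (fun t => side (rotx s) (roty s) (c s) t i j).
Proof.
move=> t; rewrite /side; apply: cvgB; apply: cvgM; try exact: cvg_cst;
  by apply: cvgB; [exact: cvg_cst|exact: cvg_id].
Qed.

Let L_closed k t s : ~ L k s t -> \forall s' \near s, ~ L k s' t.
Proof.
apply: (@fits_closed _ _ _ (fun s i => rotx s i - c s)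
  (fun s => side (rotx s) (roty s) (c s) t)) => [i|i j].
  exact: centered_continuous.
exact: side_continuous.
Qed.

Let H_closed k t s : ~ H k s t -> \forall s' \near s, ~ H k s' t.
Proof.
apply: (@fits_closed _ _ _ (fun s i => rotx s i - c s)
  (fun s i j => - side (rotx s) (roty s) (c s) t i j)) => [i|i j].
  exact: centered_continuous.
by apply: cvgN; exact: side_continuous.
Qed.

Let L_closed_t k s t : ~ L k s t -> \forall t' \near t, ~ L k s t'.
Proof.
apply: (@fits_closed _ _ _ (fun _ i => rotx s i - c s)
  (side (rotx s) (roty s) (c s))) => [i|i j]; first exact: cvg_cst.
exact: side_continuous_t.
Qed.

Let H_closed_t k s t : ~ H k s t -> \forall t' \near t, ~ H k s t'.
Proof.
apply: (@fits_closed _ _ _ (fun _ i => rotx s i - c s)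
  (fun t i j => - side (rotx s) (roty s) (c s) t i j)) => [i|i j].
  exact: cvg_cst.
by apply: cvgN; exact: side_continuous_t.
Qed.

Lemma median_opp : c (-1) = - c 1.
Proof.
have rx i : rotx (-1) i = - rotx 1 i by rewrite /rotx; ring.
have med' : is_median S M (rotx (-1)) (- c 1).
  have [h1 h2] := med 1; split; [apply: leq_trans h2 _|apply: leq_trans h1 _];
    apply/subset_leq_card/fintype.subsetP => i;
    by rewrite !inE rx => /andP[->] /=; lra.
have := median_le (e := 0) card_S _ (med (-1)) med'.
have := median_le (e := 0) card_S _ med' (med (-1)).
by rewrite !addr0 => h1 h2; apply/le_anti; rewrite h1 ?h2 // => i _; rewrite addr0.
Qed.

(* The two heights at which the k1-st and k2-nd lines meet the median line    *)
(* exchange their order during half a turn.                                   *)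
Lemma concurrent_lines k1 k2 : (k1 <= M)%N -> (k2 <= M)%N ->
  exists s t, [/\ L k1 s t, H k1 s t, L k2 s t & H k2 s t].
Proof.
move=> k1M k2M.
have LH k s t : (k <= M)%N -> L k s t \/ H k s t by move=> kM; exact: low_or_high.
(* In t, [L k] is an upward ray, [H k] a downward one, and they overlap. [A s] says that the ray
   [L k2] starts no higher than [H k1] ends, [B s] the same with k1 and k2 exchanged; one of them
   always holds. *)
pose A s := forall t, H k1 s t \/ L k2 s t.
pose B s := forall t, L k1 s t \/ H k2 s t.
have AB s : A s \/ B s.
  apply: contrapT => /not_orP[/existsNP[t /not_orP[nH1 nL2]] /existsNP[t' /not_orP[nL1 nH2]]].
  have L1 : L k1 s t by case: (LH k1 s t k1M).
  have H2 : H k2 s t by case: (LH k2 s t k2M).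
  have [tt|tt] := leP t t'; first by apply: nL1; exact: low_le L1.
  by apply: nH2; exact: high_ge (ltW tt) H2.
have cA s : ~ A s -> \forall s' \near s, ~ A s'.
  move=> /existsNP[t /not_orP[nH nL]].
  by apply: filterS2 (H_closed nH) (L_closed nL) => s' ? ? /(_ t)[].
have cB s : ~ B s -> \forall s' \near s, ~ B s'.
  move=> /existsNP[t /not_orP[nL nH]].
  by apply: filterS2 (L_closed nL) (H_closed nH) => s' ? ? /(_ t)[].
have ox i : rotx (-1) i = - rotx 1 i by rewrite /rotx; ring.
have oy i : roty (-1) i = - roty 1 i by rewrite /roty; ring.
have L1 k t : L k 1 (- t) -> H k (-1) t.
  by move=> /(low_high_opp ox oy); rewrite opprK -median_opp.
have H1 k t : H k 1 (- t) -> L k (-1) t.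
  by move=> /(high_low_opp ox oy); rewrite opprK -median_opp.
(* The half turn from 1 to -1 turns [A] into [B] and conversely, so both occur. *)
have [a [b [Aa Bb]]] : exists a b, A a /\ B b.
  have [A1|B1] := AB 1.
    exists 1, (-1); split=> // t; case: (A1 (- t)) => [/H1|/L1]; by [left|right].
  exists (-1), 1; split=> // t; case: (B1 (- t)) => [/L1|/H1]; by [left|right].
have [s [As Bs]] := closed_cover_meet Aa Bb AB cA cB.
(* Second use of connectedness, along the median line at the fixed s: [A s] and [B s] make [Up] and
   [Dn] cover it. *)
pose Up t := L k1 s t /\ L k2 s t.
pose Dn t := H k1 s t /\ H k2 s t.
have [t1 lt1] := low_large (roty s) (med s) k1M.
have [t2 lt2] := low_large (roty s) (med s) k2M.
have [u1 hu1] := high_small (roty s) (med s) k1M.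
have [u2 hu2] := high_small (roty s) (med s) k2M.
have Up0 : Up (Num.max t1 t2).
  by split; [apply: lt1|apply: lt2]; rewrite le_max lexx ?orbT.
have Dn0 : Dn (Num.min u1 u2).
  by split; [apply: hu1|apply: hu2]; rewrite ge_min lexx ?orbT.
have UD t : Up t \/ Dn t.
  have [u|nu] := pselect (Up t); first by left.
  right; have [l1|nl1] := pselect (L k1 s t).
    have nl2 : ~ L k2 s t by move=> l2; apply: nu.
    by split; [case: (As t)|case: (LH k2 s t k2M)].
  by split; [case: (LH k1 s t k1M)|case: (Bs t)].
have cU t : ~ Up t -> \forall t' \near t, ~ Up t'.
  move=> /not_andP[n|n]; apply: filterS (L_closed_t n) => t' ? []; done.
have cD t : ~ Dn t -> \forall t' \near t, ~ Dn t'.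
  move=> /not_andP[n|n]; apply: filterS (H_closed_t n) => t' ? []; done.
have [t [[? ?] [? ?]]] := closed_cover_meet Up0 Dn0 UD cU cD.
by exists s, t.
Qed.

End Sweep.

(** * Six sectors *)

Section Sectors.
Variables (R : realType) (I : finType) (S : {set I}) (x y : I -> R).
Hypothesis gp : forall i j k, uniq [:: i; j; k] ->
  det3 (x i, y i) (x j, y j) (x k, y k) != 0.

(** This bounds by 2 every loss of points on a sector boundary. *)
Lemma card_on_line (A : {set I}) (a b d : R) : a != 0 \/ b != 0 ->
  (forall i, i \in A -> a * x i + b * y i = d) -> (#|A| <= 2)%N.
Proof.
move=> ab onA; rewrite leqNgt; apply/negP => /card_gt2P[i [j [k [[iA jA kA] [ij jk ki]]]]].
have u : uniq [:: i; j; k] by rewrite /= !inE negb_or ij jk eq_sym ki.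
have ei := onA i iA; have ej := onA j jA; have ek := onA k kA.
have da : a * det3 (x i, y i) (x j, y j) (x k, y k) = 0.
  have -> : a * det3 (x i, y i) (x j, y j) (x k, y k) =
    ((a * x j + b * y j) - (a * x i + b * y i)) * (y k - y i) -
    ((a * x k + b * y k) - (a * x i + b * y i)) * (y j - y i) by rewrite /det3 /=; ring.
  by rewrite ei ej ek; ring.
have db : b * det3 (x i, y i) (x j, y j) (x k, y k) = 0.
  have -> : b * det3 (x i, y i) (x j, y j) (x k, y k) =
    ((a * x k + b * y k) - (a * x i + b * y i)) * (x j - x i) -
    ((a * x j + b * y j) - (a * x i + b * y i)) * (x k - x i) by rewrite /det3 /=; ring.
  by rewrite ei ej ek; ring.
case: ab => h; [move/eqP: da|move/eqP: db]; rewrite mulf_eq0 (negPf h) /=;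
  by apply/negP; exact: gp.
Qed.

Lemma separating_threshold (U V A B : {set I}) (f : I -> R) :
  U \subset A -> V \subset B ->
  (forall i j, i \in U -> j \in V -> f i <= f j) ->
  exists z, (#|U| <= #|below A f z|)%N /\ (#|V| <= #|above B f z|)%N.
Proof.
move=> UA VB fUV; have [U0|[i0 i0U]] := set_0Vmem U.
  exists (- \sum_i `|f i|); rewrite U0 cards0; split=> //.
  apply/subset_leq_card/fintype.subsetP => j jV; rewrite inE (fintype.subsetP VB) //=.
  rewrite lerNl; apply: le_trans (ler_norm _) _; rewrite normrN.
  by rewrite [leRHS](bigD1 j) //= lerDl sumr_ge0.
have [i iU maxi] : exists2 i, i \in U & forall j, j \in U -> f j <= f i.
  by case: (@arg_maxP _ R I i0 (mem U) f i0U) => j jU h; exists j.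
exists (f i); split; apply/subset_leq_card/fintype.subsetP => j jU.
  by rewrite inE (fintype.subsetP UA) //= maxi.
by rewrite inE (fintype.subsetP VB) //= fUV.
Qed.

Variables (M : nat) (c t : R).
Hypotheses (card_S : #|S| = M.*2.+1) (med : is_median S M x c).

Let right := [set i in S | c < x i].
Let left := [set i in S | x i < c].
Let slope i := (y i - t) / (x i - c).

Let card_on_median (A : {set I}) : (forall i, i \in A -> x i = c) -> (#|A| <= 2)%N.
Proof.
move=> h; apply: (@card_on_line A 1 0 c); first by left; rewrite oner_eq0.
by move=> i iA; rewrite mul1r mul0r addr0 h.
Qed.

Let card_slope (A : {set I}) z : (forall i, i \in A -> x i != c /\ slope i = z) ->
  (#|A| <= 2)%N.
Proof.
move=> h; apply: (@card_on_line A (- z) 1 (t - z * c)).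
  by right; rewrite oner_eq0.
move=> i iA; have [xc <-] := h i iA; rewrite /slope; field.
by rewrite subr_eq0.
Qed.


Let split_card (A B C : {set I}) : A \subset B :|: C -> (#|A| <= #|B| + #|C|)%N.
Proof. by move=> /subset_leq_card h; apply: leq_trans h (leq_card_setU _ _). Qed.

Let right_le : (#|right| <= M)%N.
Proof.
have [h _] := med.
have : (#|below S x c| + #|right|)%N = #|S|.
  rewrite -(cardsID [set i | x i <= c] S); congr (_ + _)%N; apply: eq_card => i.
    by rewrite !inE andbC.
  by rewrite !inE -ltNge andbC.
rewrite card_S; lia.
Qed.

Let left_le : (#|left| <= M)%N.
Proof.
have [_ h] := med; have := card_below_lt S x c; rewrite -/left card_S; lia.
Qed.

Let right_ge : (M <= #|right|.+1)%N.
Proof.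
have [_ h] := med.
have : (#|above S x c| <= #|right| + #|[set i in S | x i == c]|)%N.
  by apply: split_card; apply/fintype.subsetP => i; rewrite !inE le_eqVlt eq_sym =>
    /andP[->] /orP[->|->]; rewrite ?orbT.
have : (#|[set i in S | x i == c]| <= 2)%N.
  by apply: card_on_median => i; rewrite inE => /andP[_ /eqP].
lia.
Qed.

Let left_ge : (M <= #|left|.+1)%N.
Proof.
have [h _] := med.
have : (#|below S x c| <= #|left| + #|[set i in S | x i == c]|)%N.
  by apply: split_card; apply/fintype.subsetP => i; rewrite !inE le_eqVlt =>
    /andP[->] /orP[->|->]; rewrite ?orbT.
have : (#|[set i in S | x i == c]| <= 2)%N.
  by apply: card_on_median => i; rewrite inE => /andP[_ /eqP].
lia.
Qed.

Let off_median (U T : {set I}) : (forall i, i \in U -> x i != c -> i \in T) ->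
  (#|U| <= #|U :&: T| + 2)%N.
Proof.
move=> h; apply: leq_trans (_ : _ <= #|U :&: T| + #|U :\: T|)%N _.
  by rewrite cardsID.
rewrite leq_add2l; apply: card_on_median => i; rewrite inE => /andP[iT iU].
by apply/eqP; apply: contraNT iT; exact: h.
Qed.

Let slopeE i : x i != c -> y i - t = slope i * (x i - c).
Proof. by move=> h; rewrite /slope divfK // subr_eq0. Qed.

Let side_le i j : i \in right -> j \in left -> side x y c t i j <= 0 ->
  slope i <= slope j.
Proof.
rewrite !inE => /andP[_ ic] /andP[_ jc]; rewrite /side.
rewrite !slopeE ?(gt_eqF ic) ?(lt_eqF jc) // => h.
rewrite leNgt; apply/negP => ij.
have u : 0 < x i - c by lra.
have w : 0 < c - x j by lra.
have := mulr_gt0 (mulr_gt0 u w) (_ : 0 < slope i - slope j); rewrite subr_gt0 => /(_ ij); lra.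
Qed.

Let side_ge i j : i \in right -> j \in left -> - side x y c t i j <= 0 ->
  slope j <= slope i.
Proof.
rewrite !inE => /andP[_ ic] /andP[_ jc]; rewrite /side.
rewrite !slopeE ?(gt_eqF ic) ?(lt_eqF jc) // => h.
rewrite leNgt; apply/negP => ij.
have u : 0 < x i - c by lra.
have w : 0 < c - x j by lra.
have := mulr_gt0 (mulr_gt0 u w) (_ : 0 < slope j - slope i); rewrite subr_gt0 => /(_ ij); lra.
Qed.

Let in_right (U : {set I}) i : U \subset S -> (forall i, i \in U -> 0 <= x i - c) ->
  i \in U -> x i != c -> i \in right.
Proof.
move=> US h iU xc; rewrite inE (fintype.subsetP US) //= lt_neqAle eq_sym xc /=.
by have := h i iU; lra.
Qed.

Let in_left (U : {set I}) i : U \subset S -> (forall i, i \in U -> x i - c <= 0) ->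
  i \in U -> x i != c -> i \in left.
Proof.
move=> US h iU xc; rewrite inE (fintype.subsetP US) //= lt_neqAle xc /=.
by have := h i iU; lra.
Qed.

(** The pairwise conditions become one line of slope w through (c, t). Points with smaller slope lie
    below it on the right and above it on the left. Each term - 2 pays for points on the median
    line. *)
Let sectors_threshold k : (k <= M)%N -> low S M x y c k t -> high S M x y c k t ->
  exists w, [/\ k - 2 <= #|below right slope w|, M - k - 2 <= #|above right slope w|,
                k - 2 <= #|below left slope w| & M - k - 2 <= #|above left slope w|]%N.
Proof.
move=> kM [U [V [US VS kU kV [h1 h2 h3]]]] [V' [U' [US' VS' kV' kU' [h1' h2' h3']]]].
have := off_median (fun i => in_right US h1); have := off_median (fun i => in_left VS h2).
have := off_median (fun i => in_right US' h1'); have := off_median (fun i => in_left VS' h2').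
move=> e1 e2 e3 e4.
have [|z [z1 z2]] := @separating_threshold _ _ right left slope
    (subsetIr U right) (subsetIr V left).
  move=> i j /setIP[iU ir] /setIP[jV jl]; apply: side_le => //; exact: h3.
have [|z' [z1' z2']] := @separating_threshold _ _ left right slope
    (subsetIr U' left) (subsetIr V' right).
  move=> i j /setIP[iU ir] /setIP[jV jl]; apply: side_ge => //; exact: h3'.
by apply: (common_threshold (z := z) (z' := z')); move: right_ge left_ge; lia.
Qed.

Let slope_lt (A : {set I}) w : A \subset right \/ A \subset left ->
  (#|above A slope w| <= #|[set i in A | (w < slope i)%R]| + 2)%N.
Proof.
move=> AS; apply: leq_trans (_ : _ <= #|[set i in A | (w < slope i)%R]| + #|[set i in A | slope i == w]|)%N _.
  by apply: split_card; apply/fintype.subsetP => i; rewrite !inE le_eqVlt eq_sym =>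
    /andP[->] /orP[->|->]; rewrite ?orbT.
rewrite leq_add2l; apply: (@card_slope _ w) => i; rewrite inE => /andP[iA /eqP ->].
split=> //; case: AS => /fintype.subsetP/(_ i iA); rewrite inE => /andP[_ h].
  by rewrite gt_eqF.
by rewrite lt_eqF.
Qed.

Let slope_gt (A : {set I}) w : A \subset right \/ A \subset left ->
  (#|below A slope w| <= #|[set i in A | (slope i < w)%R]| + 2)%N.
Proof.
move=> AS; apply: leq_trans (_ : _ <= #|[set i in A | (slope i < w)%R]| + #|[set i in A | slope i == w]|)%N _.
  by apply: split_card; apply/fintype.subsetP => i; rewrite !inE le_eqVlt =>
    /andP[->] /orP[->|->]; rewrite ?orbT.
rewrite leq_add2l; apply: (@card_slope _ w) => i; rewrite inE => /andP[iA /eqP ->].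
split=> //; case: AS => /fintype.subsetP/(_ i iA); rewrite inE => /andP[_ h].
  by rewrite gt_eqF.
by rewrite lt_eqF.
Qed.

(** Inclusion-exclusion: two subsets of at least 2q - 4 points each, after dropping two points on
    each bounding line, inside a set of at most 3q. *)
Let middle (A : {set I}) q z1 z2 : A \subset right \/ A \subset left -> (#|A| <= 3 * q)%N ->
  (2 * q - 2 <= #|above A slope z1|)%N -> (2 * q - 2 <= #|below A slope z2|)%N ->
  (q - 8 <= #|[set i in A | (z1 < slope i)%R && (slope i < z2)%R]|)%N.
Proof.
move=> AS Aq a1 a2; have := slope_lt z1 AS; have := slope_gt z2 AS.
set B1 := [set i in A | slope i < z2]; set B2 := [set i in A | z1 < slope i] => b1 b2.
have -> : [set i in A | (z1 < slope i)%R && (slope i < z2)%R] = B1 :&: B2.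
  by apply/setP => i; rewrite !inE; case: (i \in A) => //=; rewrite andbC.
have := cardsUI B1 B2.
have : (#|B1 :|: B2| <= #|A|)%N.
  by apply/subset_leq_card/fintype.subsetP => i; rewrite !inE => /orP[] /andP[].
lia.
Qed.

(* Odd and even sectors, numbered counterclockwise starting from the downward *)
(* half of the median line.                                                   *)
Let label z1 z2 i : bool * 'I_3 :=
  if c < x i then
    if slope i <= z1 then (true, inord 0)
    else if z2 <= slope i then (true, inord 1) else (false, inord 2)
  else
    if slope i <= z1 then (false, inord 0)
    else if z2 <= slope i then (false, inord 1) else (true, inord 2).

Lemma six_sectors q : M = (3 * q)%N -> (8 < q)%N ->
  low S M x y c q t -> high S M x y c q t ->
  low S M x y c (2 * q) t -> high S M x y c (2 * q) t ->
  exists (D : {set I}) (lab : I -> bool * 'I_3),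
    [/\ D \subset S,
        forall l, (q - 8 <= #|[set i in D | lab i == l]|)%N &
        forall b i j k, i \in D -> j \in D -> k \in D ->
          lab i = (b, inord 0) -> lab j = (b, inord 1) -> lab k = (b, inord 2) ->
          in_triangle (x i, y i) (x j, y j) (x k, y k) (c, t)].
Proof.
move=> Mq q8 l1 h1 l2 h2.
have [|z1 [a1 a2 a3 a4]] := sectors_threshold _ l1 h1; first by lia.
have [|z2 [b1 b2 b3 b4]] := sectors_threshold _ l2 h2; first by lia.
have mr : (q - 8 <= #|[set i in right | (z1 < slope i)%R && (slope i < z2)%R]|)%N.
  by apply: middle; [left|move: right_le; lia|lia|lia].
have ml : (q - 8 <= #|[set i in left | (z1 < slope i)%R && (slope i < z2)%R]|)%N.
  by apply: middle; [right|move: left_le; lia|lia|lia].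
(* The middle sector is nonempty because q > 8; this keeps the labels consistent. *)
have z12 : z1 < z2.
  have /card_gt0P[i] : (0 < #|[set i in right | (z1 < slope i)%R && (slope i < z2)%R]|)%N by lia.
  by rewrite inE => /and3P[_]; exact: lt_trans.
have lab_inj (b b' : bool) (n n' : nat) : (b, inord n : 'I_3) = (b', inord n') ->
    (n < 3)%N -> (n' < 3)%N -> b = b' /\ n = n'.
  by move=> [<- /(congr1 val)] + n3 n3'; rewrite /= !inordK.
exists (right :|: left), (label z1 z2); split.
- by apply/fintype.subsetP => i; rewrite !inE => /orP[] /andP[].
- have cls (T : {set I}) l : (q - 8 <= #|T|)%N -> (T \subset right \/ T \subset left) ->
      (forall i, i \in T -> label z1 z2 i = l) ->
      (q - 8 <= #|[set i in right :|: left | label z1 z2 i == l]|)%N.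
    move=> qT TD Tl; apply: leq_trans qT _; apply/subset_leq_card/fintype.subsetP => i iT.
    rewrite inE Tl // eqxx andbT inE.
    by case: TD => /fintype.subsetP/(_ i iT) ->; rewrite ?orbT.
  have sub (A : {set I}) (P : pred I) : [set i in A | P i] \subset A.
    by apply/fintype.subsetP => i; rewrite inE => /andP[].
  case=> b k; have [k0|k0] := eqVneq k (inord 0).
    rewrite {}k0; case: b.
      apply: (cls (below right slope z1)); [lia|left; exact: sub|] => i.
      by rewrite !inE /label => /andP[/andP[_ ->] ->].
    apply: (cls (below left slope z1)); [lia|right; exact: sub|] => i.
    by rewrite !inE /label => /andP[/andP[_ /lt_gtF ->] ->].
  have [k1|k1] := eqVneq k (inord 1).
    rewrite {}k1; case: b.
      apply: (cls (above right slope z2)); [lia|left; exact: sub|] => i.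
      rewrite !inE /label => /andP[/andP[_ ->] h].
      by rewrite leNgt (lt_le_trans z12 h) h.
    apply: (cls (above left slope z2)); [lia|right; exact: sub|] => i.
    rewrite !inE /label => /andP[/andP[_ /lt_gtF ->] h].
    by rewrite leNgt (lt_le_trans z12 h) h.
  have {k0 k1}-> : k = inord 2.
    apply/val_inj; move: k0 k1; rewrite -!val_eqE /= !inordK //.
    by case: k => -[|[|[|]]].
  case: b.
    apply: (cls _ _ ml); first by right; exact: sub.
    move=> i; rewrite !inE /label => /andP[/andP[_ /lt_gtF ->] /andP[h h']].
    by rewrite !leNgt h h'.
  apply: (cls _ _ mr); first by left; exact: sub.
  by move=> i; rewrite !inE /label => /andP[/andP[_ ->] /andP[h h']]; rewrite !leNgt h h'.
(* With this product, containment of (c, t) is read off from the sides of the median line and the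
   order of slopes. *)
have det i j : i \in right :|: left -> j \in right :|: left ->
    det3 (x i, y i) (x j, y j) (c, t) = (x i - c) * (x j - c) * (slope j - slope i).
  move=> iD jD; have xc l : l \in right :|: left -> x l != c.
    by rewrite !inE => /orP[] /andP[_ h]; rewrite ?(gt_eqF h) ?(lt_eqF h).
  have := slopeE (xc _ iD); have := slopeE (xc _ jD).
  rewrite (_ : det3 _ _ _ = (x i - c) * (y j - t) - (y i - t) * (x j - c)).
    by move=> -> ->; ring.
  by rewrite /det3 /=; ring.
have lt i : i \in right :|: left -> ~~ (c < x i) -> x i < c.
  by rewrite !inE => /orP[] /andP[_ h] //; rewrite h.
have inv i b (n : nat) : i \in right :|: left -> (n < 3)%N -> label z1 z2 i = (b, inord n) ->
    [\/ n = 0%N /\ slope i <= z1 /\ (if b then c < x i else x i < c),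
        n = 1%N /\ z2 <= slope i /\ (if b then c < x i else x i < c) |
        n = 2%N /\ z1 <= slope i <= z2 /\ (if b then x i < c else c < x i)].
  move=> iD n3; rewrite /label.
  have [xc|/negP/negP/(lt i iD) xc] := boolP (c < x i); (have [g1|g1] := leP (slope i) z1;
    last have [g2|g2] := leP z2 (slope i)) => e; have [<- <-] := lab_inj _ _ _ _ e isT n3;
    by [constructor 1|constructor 2|constructor 3; rewrite (ltW g1) (ltW g2)].
move=> b i j k iD jD kD /(inv i b 0%N iD isT)[] [] // _ [si xi]
  /(inv j b 1%N jD isT)[] [] // _ [sj xj] /(inv k b 2%N kD isT)[] [] // _ [/andP[sk sk'] xk].
rewrite /in_triangle !det //; case: b xi xj xk => xi xj xk.
- split.
  + by rewrite mulr_ge0 ?mulr_ge0 //; lra.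
  + by rewrite mulr_le0 ?mulr_ge0_le0 //; lra.
  + by rewrite mulr_le0 ?mulr_le0_ge0 //; lra.
split.
+ by rewrite mulr_ge0 ?mulr_le0 //; lra.
+ by rewrite mulr_le0 ?mulr_le0_ge0 //; lra.
+ by rewrite mulr_le0 ?mulr_ge0_le0 //; lra.
Qed.

End Sectors.

Section ConcurrentSectors.
Variables (R : realType) (I : finType) (S : {set I}) (P : I -> R * R).
Hypothesis gp : forall i j k, uniq [:: i; j; k] -> det3 (P i) (P j) (P k) != 0.

Lemma concurrent_sectors q : #|S| = (6 * q).+1 -> (8 < q)%N ->
  exists (o : R * R) (D : {set I}) (lab : I -> bool * 'I_3),
    [/\ D \subset S,
        forall l, (q - 8 <= #|[set i in D | lab i == l]|)%N &
        forall b i j k, i \in D -> j \in D -> k \in D ->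
          lab i = (b, inord 0) -> lab j = (b, inord 1) -> lab k = (b, inord 2) ->
          in_triangle (P i) (P j) (P k) o].
Proof.
move=> Sq q8; have SM : #|S| = (3 * q).*2.+1 by rewrite Sq; lia.
pose X i := (P i).1; pose Y i := (P i).2.
have [c med] : exists c : R -> R, forall s, is_median S (3 * q) (rotx X Y s) (c s).
  by have /choice[c cP] := fun s => median_exists (rotx X Y s) SM; exists c.
have [|//|s [t [l1 h1 l2 h2]]] := concurrent_lines SM med (_ : q <= 3 * q)%N (_ : 2 * q <= 3 * q)%N.
- lia.
- lia.
pose r := 1 - s * s; pose d := s * s + r * r.
have d0 : 0 < d.
  rewrite lt0r addr_ge0 -?expr2 ?sqr_ge0 // andbT; apply/eqP => /eqP.
  rewrite paddr_eq0 ?sqr_ge0 // !sqrf_eq0 => /andP[/eqP s0].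
  by rewrite /r s0 mul0r subr0 oner_eq0.
(* The preimage of (c s, t) under the rotation and scaling; its determinant d is positive, so
   orientations are kept. *)
pose o := ((s * c s - r * t) / d, (r * c s + s * t) / d).
have rot i j k : det3 (rotx X Y s i, roty X Y s i) (rotx X Y s j, roty X Y s j)
    (rotx X Y s k, roty X Y s k) = d * det3 (P i) (P j) (P k).
  by rewrite /det3 /rotx /roty /d /r /X /Y /=; ring.
have roto i j : det3 (rotx X Y s i, roty X Y s i) (rotx X Y s j, roty X Y s j)
    (c s, t) = d * det3 (P i) (P j) o.
  rewrite /det3 /o /rotx /roty /= -/r -/(X i) -/(X j) -/(Y i) -/(Y j).
  rewrite /d; field; exact: lt0r_neq0.
have gp' i j k : uniq [:: i; j; k] -> det3 (rotx X Y s i, roty X Y s i)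
    (rotx X Y s j, roty X Y s j) (rotx X Y s k, roty X Y s k) != 0.
  by move=> u; rewrite rot mulf_neq0 ?gp // lt0r_neq0.
have [D [lab [DS cls tri]]] := six_sectors gp' SM (med s) erefl q8 l1 h1 l2 h2.
exists o, D, lab; split=> // b i j k iD jD kD bi bj bk.
have [] := tri b i j k iD jD kD bi bj bk.
by rewrite !roto !pmulr_rge0.
Qed.

End ConcurrentSectors.

(** * Decompositions with pairwise intersecting members *)

Section Packing.
Variables (R : realType) (n : nat) (p : 'I_n -> 'rV[R]_2).
Implicit Types (A B : {set 'I_n}) (F : {set {set 'I_n}}).

Lemma edge_in A : (1 < #|A|)%N -> exists e : edge n, edge_of A e.
Proof.
move=> /card_gt1P[i [j [iA jA ij]]].
have e2 : #|[set i; j]%SET| == 2%N by rewrite cards2 ij.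
by exists (exist (fun e : {set 'I_n} => #|e| == 2%N) _ e2); rewrite /edge_of /= finset.subUset !finset.sub1set iA.
Qed.

Lemma packing_decomposition F : (forall A, A \in F -> A != finset.set0) ->
  (forall A B, A \in F -> B \in F -> A != B -> (#|A :&: B| <= 1)%N) ->
  exists P : decomposition n, F \subset members P.
Proof.
move=> F0 F1.
(* Edges not covered by F become members of their own. *)
pose G := F :|: [set B : {set 'I_n} | (#|B| == 2)%N && [forall A in F, ~~ (B \subset A)]]%SET.
have G0 A : A \in G -> A != finset.set0.
  rewrite !inE => /orP[/F0 //|/andP[A2 _]].
  by apply: contraTneq A2 => ->; rewrite cards0.
have GE (e : edge n) : exists! A, A \in G /\ val e \subset A.
  have [A|nA] := pickP (fun A => (A \in F) && (val e \subset A)).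
    move=> /andP[AF eA]; exists A; split=> [|B [BG eB]].
      by rewrite inE AF.
    move: BG; rewrite !inE => /orP[BF|/andP[B2 /forall_inP/(_ A AF)]].
      apply/eqP; apply/negP => /negP/(F1 _ _ AF BF); apply/negP; rewrite -ltnNge.
      by rewrite -(eqP (valP e)); apply: subset_leq_card; rewrite finset.subsetI eA.
    suff /eqP <- : val e == B by rewrite eA.
    by rewrite eqEcard eB (eqP B2) (eqP (valP e)).
  exists (val e); split=> [|B [BG eB]].
    split; last exact: fintype.subxx.
    rewrite !inE (valP e) /=; apply/orP; right; apply/forall_inP => A AF.
    by have := nA A; rewrite AF /= => ->.
  move: BG; rewrite !inE => /orP[BF|/andP[B2 _]].
    by have := nA B; rewrite BF (eB : val e \subset B).
  by apply/eqP; rewrite eqEcard eB (eqP B2) (eqP (valP e)).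
by exists (Decomposition G0 GE); exact: finset.subsetUl.
Qed.

(** Sending a member of F to the color of one of its edges is injective; two vertices per member
    guarantee such an edge. *)
Lemma chromatic_index_clique (P : decomposition n) F : F \subset members P ->
  (forall A, A \in F -> (1 < #|A|)%N) ->
  (forall A B, A \in F -> B \in F -> A != B -> intersecting p A B) ->
  (#|F| <= chromatic_index p P)%N.
Proof.
move=> /fintype.subsetP FP F2 FI; rewrite /chromatic_index.
case: ex_minnP => k /asboolP[c [_ cP]] _.
have [->|[A0 A0F]] := set_0Vmem F; first by rewrite cards0.
have [e0 _] := edge_in (F2 A0 A0F).
have /choice[g gP] A : exists e : edge n, A \in F -> edge_of A e.
  by case: (boolP (A \in F)) => [/F2/edge_in[e eA]|_]; [exists e|exists e0].
have inj : {in F &, injective (fun A => c (g A))}.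
  move=> A B AF BF /eqP ccE; apply/eqP; apply: contraTT ccE => AB.
  exact: cP (FP _ AF) (FP _ BF) AB (FI _ _ AF BF AB) _ _ (gP _ AF) (gP _ BF).
by rewrite -(card_in_imset inj) -[leqRHS]card_ord max_card.
Qed.

End Packing.

(** * From meeting segments to intersecting members *)

Section Intersections.
Variables (R : realType) (n : nat) (p : 'I_n -> 'rV[R]_2).
Hypothesis gp : general_position p.

Let P i : R * R := (p i ord0 ord0, p i ord0 ord_max).

Lemma det3_general_position i j k : uniq [:: i; j; k] -> det3 (P i) (P j) (P k) != 0.
Proof.
move=> u; apply/eqP => D0; have [inj /(_ _ _ _ u)] := gp; apply.
have ij : i != j by move: u; rewrite /= !inE negb_or => /andP[/andP[]].
exists (p i), (p j - p i); split; first by rewrite subr_eq0 eq_sym (inj_eq inj).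
have two (q : 'rV[R]_2) a b : q = p a + b *: (p j - p i) <->
    (q ord0 ord0 = (P a).1 + b * ((P j).1 - (P i).1) /\
     q ord0 ord_max = (P a).2 + b * ((P j).2 - (P i).2)).
  split=> [->|[e1 e2]]; first by rewrite !mxE.
  apply/rowP => l; rewrite !mxE; case: l => -[|[|//]] l2.
    by rewrite (_ : Ordinal l2 = ord0) //; exact: val_inj.
  by rewrite (_ : Ordinal l2 = ord_max) //; exact: val_inj.
split; [exists 0 => //; by rewrite scale0r addr0|by exists 1; rewrite // scale1r addrC subrK|].
have ne : (P j).1 - (P i).1 != 0 \/ (P j).2 - (P i).2 != 0.
  apply/or_asboolP; rewrite !asboolb -negb_and; apply: contraNN ij => /andP[/eqP h1 /eqP h2].
  apply/eqP/inj/esym; apply: etrans (proj2 (two (p j) i 0) _) _.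
    by rewrite !mul0r !addr0 -/(P j).1 -/(P j).2 -(subr0_eq h1) -(subr0_eq h2).
  by rewrite scale0r addr0.
move: D0; rewrite /det3 => D0; case: ne => ne.
  exists (((P k).1 - (P i).1) / ((P j).1 - (P i).1)) => //; apply/esym/two.
  rewrite divfK //; split; first by rewrite addrC subrK.
  have -> : ((P k).1 - (P i).1) / ((P j).1 - (P i).1) * ((P j).2 - (P i).2) = (P k).2 - (P i).2.
    by apply: (mulIf ne); rewrite mulrAC divfK //; lra.
  by rewrite addrC subrK.
exists (((P k).2 - (P i).2) / ((P j).2 - (P i).2)) => //; apply/esym/two.
rewrite divfK //; split; last by rewrite addrC subrK.
have -> : ((P k).2 - (P i).2) / ((P j).2 - (P i).2) * ((P j).1 - (P i).1) = (P k).1 - (P i).1.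
  by apply: (mulIf ne); rewrite mulrAC divfK //; lra.
by rewrite addrC subrK.
Qed.

Let gpP := det3_general_position.

Lemma meet_intersecting (s t : seq 'I_n) (A B : {set 'I_n}) : uniq (s ++ t) ->
  {subset s <= A} -> {subset t <= B} -> meet P s t -> intersecting p A B.
Proof.
rewrite cat_uniq => /and3P[_ /hasPn st _] sA tB [i [j [k [l [q []]]]]].
move=> /and3P[si sj ij] /and3P[tk tl kl] q1 q2; right.
have ne (a b : 'I_n) : a \in s -> b \in t -> a != b.
  by move=> sa /st; apply: contraNneq => <-.
have u (a b c : 'I_n) : a != b -> a != c -> b != c -> uniq [:: a; b; c].
  by move=> ab ac bc; rewrite /= !inE negb_or ab ac bc.
have [r r01 qr] := on_segment_interior gpP (u _ _ _ (ne _ _ si tk) (ne _ _ si tl) kl) (u _ _ _ (ne _ _ sj tk) (ne _ _ sj tl) kl) q1 q2.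
have ne' (a b : 'I_n) : a \in t -> b \in s -> a != b by move=> ta sb; rewrite eq_sym; exact: ne.
have [r' r'01 qr'] := on_segment_interior gpP (u _ _ _ (ne' _ _ tk si) (ne' _ _ tk sj) ij) (u _ _ _ (ne' _ _ tl si) (ne' _ _ tl sj) ij) q2 q1.
have e2 (a b : 'I_n) : a != b -> #|[set a; b]%SET| == 2%N by move=> ab; rewrite cards2 ab.
exists (exist (fun e : {set 'I_n} => #|e| == 2%N) _ (e2 _ _ ij)).
exists (exist (fun e : {set 'I_n} => #|e| == 2%N) _ (e2 _ _ kl)).
split; rewrite /edge_of /= ?finset.subUset ?finset.sub1set ?sA ?tB //.
exists ((1 - r) *: p i + r *: p j); split.
  by exists i, j; split=> //; exists r; rewrite //= in_itv.
exists k, l; split=> //; exists r'; rewrite /= ?in_itv //.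
move: qr'; rewrite qr => -[e1 e2']; apply/rowP => h; rewrite !mxE.
case: h => -[|[|//]] h.
  by rewrite (_ : Ordinal h = ord0); [exact/esym|exact: val_inj].
by rewrite (_ : Ordinal h = ord_max); [exact/esym|exact: val_inj].
Qed.

(** A point of the triangle would be, by general position, a mean of the vertices with positive
    weights. Being at least as far right as each of them, it would have the same first coordinate as
    all three, which would then be collinear; this also settles ties. *)
Lemma rightmost_outside i j k l : uniq [:: i; j; k; l] ->
  (forall h, h \in [:: i; j; k] -> (P h).1 <= (P l).1) ->
  ~ in_triangle (P i) (P j) (P k) (P l).
Proof.
rewrite /= !inE !negb_or !andbT => /and3P[/and3P[ij ik il] /andP[jk jl] kl] le_l [h1 h2 h3].
have u (a b c : 'I_n) : a != b -> a != c -> b != c -> uniq [:: a; b; c].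
  by move=> ab ac bc; rewrite /= !inE negb_or ab ac bc.
have {}h1 : 0 < det3 (P i) (P j) (P l) by rewrite lt0r h1 gpP // u.
have {}h2 : 0 < det3 (P j) (P k) (P l) by rewrite lt0r h2 gpP // u.
have {}h3 : 0 < det3 (P k) (P i) (P l) by rewrite lt0r h3 gpP // u // eq_sym.
have xi : 0 <= (P l).1 - (P i).1 by rewrite subr_ge0 le_l // !inE eqxx.
have xj : 0 <= (P l).1 - (P j).1 by rewrite subr_ge0 le_l // !inE eqxx orbT.
have xk : 0 <= (P l).1 - (P k).1 by rewrite subr_ge0 le_l // !inE eqxx !orbT.
have : det3 (P j) (P k) (P l) * ((P l).1 - (P i).1) +
    (det3 (P k) (P i) (P l) * ((P l).1 - (P j).1) +
    det3 (P i) (P j) (P l) * ((P l).1 - (P k).1)) == 0 by apply/eqP; rewrite /det3; ring.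
rewrite paddr_eq0 ?addr_ge0 ?mulr_ge0 ?(ltW h1) ?(ltW h2) ?(ltW h3) //.
rewrite paddr_eq0 ?mulr_ge0 ?(ltW h1) ?(ltW h2) ?(ltW h3) //.
rewrite !mulf_eq0 (gt_eqF h1) (gt_eqF h2) (gt_eqF h3) /= => /and3P[/eqP ei /eqP ej /eqP ek].
have := gpP (u _ _ _ ij ik jk); apply/negP; rewrite negbK.
have -> : det3 (P i) (P j) (P k) =
    (((P l).1 - (P i).1) - ((P l).1 - (P j).1)) * ((P k).2 - (P i).2) -
    ((P j).2 - (P i).2) * (((P l).1 - (P i).1) - ((P l).1 - (P k).1)) by rewrite /det3; ring.
by rewrite ei ej ek !subrr mul0r mulr0 subrr.
Qed.

Lemma tetrads_intersecting a b c d a' b' c' d' o (A B : {set 'I_n}) :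
  uniq [:: a; b; c; d] -> uniq [:: a'; b'; c'; d'] ->
  {subset [:: a; b; c; d] <= A} -> {subset [:: a'; b'; c'; d'] <= B} ->
  in_triangle (P a) (P b) (P c) o -> in_triangle (P a') (P b') (P c') o ->
  (forall h l, h \in [:: a; b; c; a'; b'; c'] -> l \in [:: d; d'] -> (P h).1 <= (P l).1) ->
  intersecting p A B.
Proof.
move=> u u' sA sB T T' le_d.
have [/hasP[x xB xA]|nst] := boolP (has (mem [:: a; b; c; d]) [:: a'; b'; c'; d']).
  by left; exists x; split; [exact: sA|exact: sB].
have uu : uniq ([:: a; b; c; d] ++ [:: a'; b'; c'; d']) by rewrite cat_uniq u nst u'.
have pos i j k l v : uniq [:: i; j; k; l] -> in_triangle (P i) (P j) (P k) v ->
    0 < det3 (P i) (P j) (P k).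
  move=> uv [h1 h2 h3]; have D0 : 0 <= det3 (P i) (P j) (P k) by rewrite -(det3_split _ _ _ v); exact: addr_ge0 (addr_ge0 h1 h2) h3.
  rewrite lt0r D0 andbT gpP //.
  by move: uv; rewrite (cat_uniq [:: i; j; k] [:: l]) => /and3P[].
have sub (i j k l h : 'I_n) : uniq [:: i; j; k; l] -> h \notin [:: i; j; k; l] ->
    uniq [:: i; j; k; h].
  rewrite /= !inE !negb_or !andbT => /and3P[/and3P[-> -> _] /andP[-> _] _].
  by case/and4P => hi hj hk _; rewrite ![_ == h]eq_sym hi hj hk.
have d_out : d \notin [:: a'; b'; c'; d'].
  by apply: contra nst => h; apply/hasP; exists d; rewrite // !inE eqxx !orbT.
have d'_out : d' \notin [:: a; b; c; d].
  by apply: contra nst => h; apply/hasP; exists d'; rewrite // !inE eqxx !orbT.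
apply: (meet_intersecting uu sA sB).
apply: (meet_tetrads uu (pos _ _ _ _ _ u T) (pos _ _ _ _ _ u' T') T T').
  apply: (rightmost_outside (sub _ _ _ _ _ u d'_out)) => h.
  by rewrite !inE => /or3P[] /eqP ->; apply: le_d; rewrite !inE eqxx ?orbT.
apply: (rightmost_outside (sub _ _ _ _ _ u' d_out)) => h.
by rewrite !inE => /or3P[] /eqP ->; apply: le_d; rewrite !inE eqxx ?orbT.
Qed.

End Intersections.

(** * The construction *)

Lemma smallest_subset (R : realDomainType) (I : finType) (f : I -> R) k :
  (k <= #|I|)%N ->
  exists2 S : {set I}, #|S| = k & forall i j, i \in S -> j \notin S -> f i <= f j.
Proof.
elim: k => [|k IH] kI; first by exists finset.set0; rewrite ?cards0 // => i j; rewrite finset.in_set0.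
have [S Sk fS] := IH (ltnW kI).
have /card_gt0P[i0 i0S] : (0 < #|~: S|)%N by have := cardsC S; rewrite Sk; lia.
have [i iS min_i] : exists2 i, i \in ~: S & forall j, j \in ~: S -> f i <= f j.
  by case: (@arg_minP _ R I i0 (mem (~: S)) f i0S) => j jS h; exists j.
rewrite finset.in_setC in iS.
exists (i |: S); first by rewrite cardsU1 iS Sk.
move=> j l; rewrite !inE negb_or => /orP[/eqP ->|jS] /andP[li lS]; last exact: fS.
by apply: min_i; rewrite finset.in_setC.
Qed.

Lemma enumerated_subset (I : finType) (A : {set I}) m : (m <= #|A|)%N ->
  exists2 g : 'I_m -> I, injective g & forall z, g z \in A.
Proof.
move=> mA; exists (fun z => enum_val (widen_ord mA z)) => [z z' /enum_val_inj/(congr1 val)|z].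
  by move=> zz; exact: val_inj.
exact: enum_valP.
Qed.

(** * A transversal design modulo an odd number *)

Section Design.
Variable h : nat.
Let Z : zmodType := 'I_h.*2.+1.
Implicit Types (x y : Z).

(** The modulus 2h + 1 is odd, and h + 1 is the inverse of 2. *)
Lemma double_inj : injective (fun y => y + y).
Proof.
have odd0 (z : Z) : z *+ h.*2.+1 = 0 by rewrite Zp_mulrn; apply/val_inj; rewrite /= modnMl.
have half (z : Z) : z = (z + z) *+ h.+1.
  by rewrite -mulr2n -mulrnA (_ : 2 * h.+1 = h.*2.+1 + 1)%N ?mulrnDr ?odd0 ?add0r //; lia.
by move=> y y' e; rewrite (half y) e -half.
Qed.

(** The default of [nth] is the fourth coordinate, x + 2y, at k = 3. *)
Definition coordinate x y (k : nat) : Z := nth (x + y + y) [:: x; y; x + y] k.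

(** Any two of the four linear forms are independent; only the pair x, x + 2y requires the modulus
    to be odd. *)
Lemma coordinates_determine x y x' y' j k : (j < k)%N -> (k < 4)%N ->
  coordinate x y j = coordinate x' y' j -> coordinate x y k = coordinate x' y' k ->
  x = x' /\ y = y'.
Proof.
case: j k => [|[|[|j]]] [|[|[|[|k]]]] //= _ _; rewrite /coordinate /=.
- by move=> -> /addrI.
- by move=> ->; rewrite -!addrA => /addrI /double_inj.
- by move=> -> /addIr.
- by move=> -> /addIr /addIr.
- move=> e; rewrite e => /addrI ye; split=> //.
  by move: e; rewrite ye => /addIr.
Qed.

(** The left summand indexes the points of the six sectors, the right one the points set aside,
    which blocks of both parities share; blocks of different parity have no other common point. *)
Definition points := (bool * 'I_3 * Z + Z)%type.

Definition block (t : bool * (Z * Z)) : {set points} :=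
  [set w : points | match w with
    | inl (b, k, z) => (b == t.1) && (z == coordinate t.2.1 t.2.2 k)
    | inr z => z == coordinate t.2.1 t.2.2 3
    end]%SET.

Lemma blocks_meet t t' v w : v != w -> v \in block t -> v \in block t' ->
  w \in block t -> w \in block t' -> t = t'.
Proof.
case: t t' => b [x y] [b' [x' y']]; rewrite !inE /=.
have goal j k : (j < k)%N -> (k < 4)%N -> b = b' ->
    coordinate x y j = coordinate x' y' j ->
    coordinate x y k = coordinate x' y' k -> (b, (x, y)) = (b', (x', y')).
  by move=> jk k4 -> e1 e2; have [-> ->] := coordinates_determine jk k4 e1 e2.
case: v w => [[[bv kv] v]|v] [[[bw kw] w]|w] ne.
- move=> /andP[/eqP bE /eqP v1] /andP[/eqP bE' /eqP v2] /andP[/eqP bwE /eqP w1] /andP[_ /eqP w2].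
  have [kvw|kvw|kvw] := ltngtP kv kw.
  + by apply: (goal _ _ kvw); rewrite -?v1 -?w1 -?bE //; exact: leq_trans (ltn_ord kw) _.
  + by apply: (goal _ _ kvw); rewrite -?v1 -?w1 -?bE //; exact: leq_trans (ltn_ord kv) _.
  + by case/negP: ne; rewrite bE bwE v1 w1 (val_inj kvw).
- move=> /andP[/eqP bE /eqP v1] /andP[/eqP bE' /eqP v2] /eqP w1 /eqP w2.
  by apply: (goal _ _ (ltn_ord kv)); rewrite -?v1 -?w1 -?bE.
- move=> /eqP v1 /eqP v2 /andP[/eqP bE /eqP w1] /andP[/eqP bE' /eqP w2].
  by apply: (goal _ _ (ltn_ord kw)); rewrite -?v1 -?w1 -?bE.
- by move=> /eqP v1 _ /eqP w1 _; rewrite v1 w1 eqxx in ne.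
Qed.

Variables (I : finType) (g : points -> I).
Hypothesis g_inj : injective g.

Definition blocks : {set {set I}} := [set g @: block t | t : bool * (Z * Z)]%SET.

Lemma block_first b x y : inl (b, inord 0, x) \in block (b, (x, y)).
Proof. by rewrite inE eqxx /coordinate /= inordK. Qed.
Lemma block_second b x y : inl (b, inord 1, y) \in block (b, (x, y)).
Proof. by rewrite inE eqxx /coordinate /= inordK. Qed.
Lemma block_third b x y : inl (b, inord 2, x + y) \in block (b, (x, y)).
Proof. by rewrite inE eqxx /coordinate /= inordK. Qed.
Lemma block_fourth b x y : inr (x + y + y) \in block (b, (x, y)).
Proof. by rewrite inE. Qed.

Lemma blocks_gt1 A : A \in blocks -> (1 < #|A|)%N.
Proof.
move=> /imsetP[[b [x y]] _ ->]; rewrite card_imset //; apply/card_gt1P.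
exists (inl (b, inord 0, x)), (inr (x + y + y)); split=> //.
  exact: block_first.
exact: block_fourth.
Qed.

Lemma blocks_linear A B : A \in blocks -> B \in blocks -> A != B ->
  (#|A :&: B| <= 1)%N.
Proof.
move=> /imsetP[t _ ->] /imsetP[t' _ ->] ne; rewrite leqNgt; apply: contra ne.
rewrite -finset.imsetI; last by move=> ? ? _ _; exact: g_inj.
rewrite card_imset // => /card_gt1P[v [w [/finset.setIP[v1 v2] /finset.setIP[w1 w2] vw]]].
by rewrite (blocks_meet vw v1 v2 w1 w2).
Qed.

Lemma card_blocks : #|blocks| = (2 * h.*2.+1 ^ 2)%N.
Proof.
rewrite card_imset; first by rewrite !card_prod card_bool !card_ord.
move=> t t' e; have tB : g @: block t \in blocks by exact: imset_f.
have /card_gt1P[v [w [vA wA vw]]] := blocks_gt1 tB.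
move: (vA) (wA); rewrite {1 2}e => /imsetP[v1 v1t ev] /imsetP[w1 w1t ew].
have vw1 : v1 != w1 by apply: contraNneq vw => vw1; rewrite ev ew vw1.
by apply: (blocks_meet vw1) => //; rewrite -(mem_imset _ _ g_inj) -?ev -?ew.
Qed.

End Design.

Section Construction.
Variables (R : realType) (n : nat) (p : 'I_n -> 'rV[R]_2).
Hypothesis gp : general_position p.

Lemma many_crossing_blocks h : (7 * (h.*2 + 9) < n)%N ->
  (* With m = 2h + 1, q is m + 8, so that each sector keeps m points; n > 7q leaves at least m
     points outside the 6q + 1 used for the sectors. *)
  exists P : decomposition n, (2 * h.*2.+1 ^ 2 <= chromatic_index p P)%N.
Proof.
move=> hn; pose q := (h.*2 + 9)%N.
pose P i : R * R := (p i ord0 ord0, p i ord0 ord_max).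
have [|S Sq SX] := @smallest_subset R 'I_n (fun i => (P i).1) (6 * q).+1.
  by rewrite card_ord /q; lia.
have [|o [D [lab [DS cls tri]]]] := concurrent_sectors (det3_general_position gp) Sq.
  by rewrite /q; lia.
have big : (h.*2.+1 <= #|~: S|)%N.
  by have := cardsC S; rewrite Sq card_ord /q; lia.
have [g' g'_inj g'S] := enumerated_subset big.
have /choice[g gP] l : exists g : 'I_h.*2.+1 -> 'I_n, injective g /\
    forall z, g z \in [set i in D | lab i == l]%SET.
  have [|g ? ?] := @enumerated_subset _ [set i in D | lab i == l]%SET h.*2.+1; last by exists g.
  by apply: leq_trans (cls l); rewrite /q; lia.
pose G (w : points h) : 'I_n := match w with inl (b, k, z) => g (b, k) z | inr z => g' z end.
have gD l z : g l z \in D /\ lab (g l z) = l.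
  by have [_ /(_ z)] := gP l; rewrite inE => /andP[? /eqP].
have gS l z : g l z \in S by apply: (fintype.subsetP DS); have [] := gD l z.
have g'nS z : g' z \notin S by have := g'S z; rewrite inE.
have G_inj : injective G.
  case=> [[[b k] z]|z] [[[b' k'] z']|z'] /= e.
  - have := congr1 lab e; rewrite (gD _ _).2 (gD _ _).2 => -[bb kk].
    by move: e; rewrite bb kk => /(gP _).1 ->.
  - by have := g'nS z'; rewrite -e gS.
  - by have := g'nS z; rewrite e gS.
  - by rewrite (g'_inj _ _ e).
have [||Q FQ] := @packing_decomposition n (blocks G).
- by move=> A /(blocks_gt1 G_inj); apply: contraTneq => ->; rewrite cards0.
- exact: blocks_linear G_inj.
exists Q; rewrite -(card_blocks G_inj).
apply: chromatic_index_clique FQ (blocks_gt1 G_inj) _ => A B.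
move=> /imsetP[[b [x y]] _ ->] /imsetP[[b' [x' y']] _ ->] _.
have sub b0 x0 y0 : {subset [:: G (inl (b0, inord 0, x0)); G (inl (b0, inord 1, y0));
    G (inl (b0, inord 2, x0 + y0)); G (inr (x0 + y0 + y0))] <= (G @: block (b0, (x0, y0)))%SET}.
  move=> w; rewrite !inE => /or4P[] /eqP ->; apply: imset_f.
  - exact: block_first.
  - exact: block_second.
  - exact: block_third.
  - exact: block_fourth.
have ne b0 j k z z' : (j < 3)%N -> (k < 3)%N -> j != k ->
    inl (b0, inord j, z) != inl (b0, inord k, z') :> points h.
  by move=> j3 k3; apply: contraNneq => -[/(congr1 val)]; rewrite /= !inordK // => ->.
have uni b0 x0 y0 : uniq [:: G (inl (b0, inord 0, x0)); G (inl (b0, inord 1, y0));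
    G (inl (b0, inord 2, x0 + y0)); G (inr (x0 + y0 + y0))].
  rewrite (map_inj_uniq G_inj [:: inl (b0, inord 0, x0); inl (b0, inord 1, y0);
    inl (b0, inord 2, x0 + y0); inr (x0 + y0 + y0)]) /= !inE.
  by rewrite !negb_or !ne.
have in_tri b0 x0 y0 : in_triangle (P (G (inl (b0, inord 0, x0))))
    (P (G (inl (b0, inord 1, y0)))) (P (G (inl (b0, inord 2, x0 + y0)))) o.
  by apply: (tri b0); rewrite ?(gD _ _).1 ?(gD _ _).2.
apply: (tetrads_intersecting gp (uni _ _ _) (uni _ _ _) (sub _ _ _) (sub _ _ _)
  (in_tri _ _ _) (in_tri _ _ _)) => i j hi hj.
apply: SX.
  by move: hi; rewrite !inE; do 5![case/orP=> [/eqP->|]; first exact: gS]; move/eqP->; exact: gS.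
by move: hj; rewrite !inE => /orP[] /eqP ->; exact: g'nS.
Qed.

End Construction.

Theorem theorem2p7 (R : realType) :
  exists f : nat -> R, Theta_n f /\
    forall (n : nat) (p : 'I_n -> 'rV[R]_2), general_position p ->
      exists P : decomposition n,
        (chromatic_index p P)%:R >= n%:R ^+ 2 / (49 / 2) - f n.
Proof.
(* The factor 20 is generous: the estimate below loses at most 2 * 140 n / 49, which is less than
   6n. *)
exists (fun n => 20 * n%:R); split.
  by exists 20, 20; split=> // n; rewrite lexx.
move=> n p gp; have n0 : 0 <= n%:R :> R by [].
have [n_small|n_large] := leqP n 70.
  (* For n at most 70 the claimed bound is not positive, so any decomposition serves. *)
  have [||P _] := @packing_decomposition n finset.set0.
  - by move=> A; rewrite finset.in_set0.
  - by move=> A B; rewrite finset.in_set0.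
  exists P; apply: le_trans (ler0n _ _).
  have : n%:R <= 70 :> R by rewrite ler_nat.
  set N := n%:R in n0 *; nra.
(* The largest h with 7(2h + 9) < n; it gives 7(2h + 1) at least n - 70. *)
pose h := ((n - 64) %/ 14)%N.
have [|P lowP] := @many_crossing_blocks R n p gp h; first by rewrite /h; lia.
exists P; have : n%:R <= 7 * (h.*2.+1 + 10)%:R :> R by rewrite -natrM ler_nat /h; lia.
have : (2 * h.*2.+1 ^ 2)%:R <= (chromatic_index p P)%:R :> R by rewrite ler_nat.
have : 70 < n%:R :> R by rewrite ltr_nat.
rewrite natrM natrX natrD; set N := n%:R; set M := h.*2.+1%:R; set K := (chromatic_index p P)%:R.
move=> N70 MK NM.
have : (N - 70) ^+ 2 <= (7 * M) ^+ 2 by rewrite ler_sqr ?nnegrE; lra.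
rewrite !expr2 in MK *; lra.
Qed.
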